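(* Let $q$ be a power of a prime $p$, $K$ the algebraic closure of $\mathbb{F}_q$, and let $m\geq 2$, $r\geq 2$ be integers with $p\nmid m$. Let $\alpha_1,\dots,\alpha_r\in K$ be pairwise distinct, let $\lambda_1,\dots,\lambda_r$ be integers with $1\leq \lambda_i<m$, put $\lambda_0:=\sum_{i=1}^r\lambda_i$, and assume $\gcd(m,\lambda_0)=1$. Let $\mathcal{X}$ be the curve defined by $y^m=\prod_{i=1}^r (x-\alpha_i)^{\lambda_i}$ and let $Q_\infty$ be its only place at infinity. Suppose that $\mathcal{X}$ is defined over $\mathbb{F}_{q^2}$, that $\gcd(m,\lambda_j)=1$ for $j=1,\dots,r$, and that $r<m$. Then $(\mathcal{X},Q_\infty)$ is an $\mathbb{F}_{q^2}$-maximal Castle curve if and only if $\mathcal{X}$ is $\mathbb{F}_{q^2}$-maximal, $\lambda_1=\cdots=\lambda_r$, and $m=q+1$.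
   Context: $\mathcal{X}$ denotes the nonsingular projective absolutely irreducible curve with function field $K(\mathcal{X})=K(x,y)$ over $K$ given by the affine equation; $Q_\infty$ is the unique place lying over the pole of $x$. That $\mathcal{X}$ is defined over $\mathbb{F}_{q^2}$ means $\prod_{i=1}^r (x-\alpha_i)^{\lambda_i}\in\mathbb{F}_{q^2}[x]$ (the place $Q_\infty$ is then $\mathbb{F}_{q^2}$-rational). $\#\mathcal{X}(\mathbb{F}_{q^2})$ is the number of $\mathbb{F}_{q^2}$-rational places (places of degree one) of $\mathcal{X}$, and $g(\mathcal{X})$ is the genus. $\mathcal{X}$ is $\mathbb{F}_{q^2}$-maximal if $\#\mathcal{X}(\mathbb{F}_{q^2})=q^2+1+2g(\mathcal{X})q$. The Weierstrass semigroup at a place $Q$ is $H(Q):=\{s\in\mathbb{N}_0 : (z)_\infty=sQ \text{ for some } z\in K(\mathcal{X})\}$, where $(z)_\infty$ is the pole divisor; its multiplicity $m_{H(Q)}$ is its smallest nonzero element; its Frobenius number $F_{H(Q)}$ is the largest element of $\mathbb{N}\setminus H(Q)$; it is symmetric if $F_{H(Q)}=2g(\mathcal{X})-1$. The pair $(\mathcal{X},Q_\infty)$ is a Castle curve (over $\mathbb{F}_{q^2}$) if $H(Q_\infty)$ is symmetric and $\#\mathcal{X}(\mathbb{F}_{q^2})=q^2m_{H(Q_\infty)}+1$; it is an $\mathbb{F}_{q^2}$-maximal Castle curve if moreover $\mathcal{X}$ is $\mathbb{F}_{q^2}$-maximal. *)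

(* Defs.v *)
From HB Require Import structures.
From mathcomp Require Import all_boot all_order all_algebra.
From mathcomp Require Import boolp classical_sets functions cardinality fsbigop.

Set Implicit Arguments.
Unset Strict Implicit.
Unset Printing Implicit Defensive.

Import Order.TTheory GRing.Theory Num.Theory.
Local Open Scope classical_set_scope.
Local Open Scope ring_scope.

Section FunctionField.
(* A function field E over a field of constants k, both given as subsets of an
   ambient field F.  All the definitions below are relative to E / k. *)
Variables (F : fieldType) (k E : set F).

(* A place is represented by its valuation ring O; the place in the sense of a
   maximal ideal is [maxideal O]. *)
Definition is_place (O : set F) : Prop :=
  [/\ subring_closed [in O], k `<` O, O `<` E
    & forall z, E z -> O z \/ O z^-1].

Definition places : set (set F) := [set O | is_place O].

Definition units_of (O : set F) : set F := [set z | [/\ O z, z != 0 & O z^-1]].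

Definition maxideal (O : set F) : set F := O `\` units_of O.

Definition uniformizer (O : set F) (t : F) : Prop :=
  maxideal O = [set t * u | u in O].

(* Normalized discrete valuation; only meaningful for z <> 0 (its value at 0 is
   a default value, so 0 is always treated apart). *)
Definition valuation (O : set F) (z : F) : int :=
  xget 0 [set n : int | exists t u,
    [/\ uniformizer O t, units_of O u & z = t ^ n * u]].

(* The quotient V / W of two k-subspaces of F has dimension n over k, i.e. it
   has a basis indexed by 'I_n. *)
Definition has_dim (V W : set F) (n : nat) : Prop :=
  exists e : 'I_n -> F, (forall i, V (e i)) /\
    forall v, V v -> exists! c : {ffun 'I_n -> F},
      (forall i, k (c i)) /\ W (v - \sum_(i < n) c i * e i).

(* 0 if the dimension is infinite. *)
Definition dim (V W : set F) : nat := xget 0%N [set n | has_dim V W n].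

Definition place_degree (O : set F) : nat := dim O (maxideal O).

Definition rational_places : set (set F) :=
  [set P | places P /\ place_degree P = 1%N].

Definition is_divisor (D : set F -> int) : Prop :=
  finite_set [set P | D P != 0] /\ [set P | D P != 0] `<=` places.

Definition divisor_degree (D : set F -> int) : int :=
  \sum_(P \in places) D P * (place_degree P)%:Z.

Definition RRspace (D : set F -> int) : set F :=
  [set z | E z /\ (z != 0 -> forall P, places P -> - D P <= valuation P z)].

Definition ell (D : set F -> int) : nat := dim (RRspace D) [set 0].

(* g = max { deg D - ell D + 1 | D divisor } *)
Definition genus : nat :=
  xget 0%N [set g : nat |
    (exists2 D, is_divisor D & g%:Z = divisor_degree D - (ell D)%:Z + 1) /\
    (forall D, is_divisor D -> divisor_degree D - (ell D)%:Z + 1 <= g%:Z)].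

Definition pole_divisor (z : F) : set F -> int :=
  fun P => Num.max 0 (- valuation P z).

Definition weierstrass (Q : set F) : set nat :=
  [set s | exists z, [/\ E z, z != 0 & forall P, places P ->
    pole_divisor z P = if P == Q then s%:Z else 0]].

End FunctionField.

Definition multiplicity (H : set nat) : nat :=
  xget 0%N [set s | [/\ H s, (0 < s)%N
                      & forall s', H s' -> (0 < s')%N -> (s <= s')%N]].

(* The Frobenius number of H is f. *)
Definition is_frobenius (H : set nat) (f : nat) : Prop :=
  ~ H f /\ forall s, ~ H s -> (s <= f)%N.

(* C(x, y), for C a subfield of K embedded in F by iota. *)
Definition function_field (K F : fieldType) (iota : K -> F) (x y : F)
    (C : set K) : set F :=
  smallest (fun A : set F => divring_closed [in A])
           (iota @` C `|` [set x; y]).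

(* For N the cardinality of a finite field and K an algebraic closure of it,
   this is the subfield with N elements of K. *)
Definition GF_sub (K : fieldType) (N : nat) : set K := [set a | a ^+ N = a].
Arguments GF_sub : clear implicits.

Section Curve.
(* The curve X with function field K(x, y) over K, which is the constant field
   extension of F_{q^2}(x, y) over F_{q^2}; iota is the embedding of K. *)
Variables (K F : fieldType) (iota : K -> F) (x y : F) (q : nat).

Definition curve_places : set (set F) :=
  places (range iota) (function_field iota x y setT).

Definition curve_genus : nat :=
  genus (range iota) (function_field iota x y setT).

Definition curve_semigroup (Q : set F) : set nat :=
  weierstrass (range iota) (function_field iota x y setT) Q.

(* X(F_{q^2}): the places of degree one of F_{q^2}(x, y) over F_{q^2}. *)
Definition curve_points : set (set F) :=
  rational_places (iota @` GF_sub K (q ^ 2))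
                  (function_field iota x y (GF_sub K (q ^ 2))).

Definition maximal_curve : Prop :=
  (curve_points #= `I_(q ^ 2 + 1 + 2 * curve_genus * q)%N)%card.

Definition symmetric_semigroup (Q : set F) : Prop :=
  exists2 f : nat, is_frobenius (curve_semigroup Q) f
                 & f%:Z = 2 * curve_genus%:Z - 1.

Definition castle_curve (Q : set F) : Prop :=
  symmetric_semigroup Q /\
  (curve_points #= `I_(q ^ 2 * multiplicity (curve_semigroup Q) + 1)%N)%card.

Definition maximal_castle_curve (Q : set F) : Prop :=
  castle_curve Q /\ maximal_curve.

End Curve.

(* Main.v *)
(* Write e_j = y^j / prod_i (x - alpha_i)^(floor (j lambda_i / m)) for j < m.
   The functions that are regular outside Q_oo are the combinations of the e_j
   with coefficients in K[x], and e_j has at Q_oo a pole of order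
   s_j = sum_i (j lambda_i mod m).  As gcd (m, lambda_0) = 1, the s_j are pairwise
   distinct modulo m, so that H(Q_oo) = {s_j + m k}.  Riemann's inequality for
   every divisor, compared with the multiples of Q_oo, shows that the genus is the
   number of gaps of H(Q_oo), hence 2 g = (m - 1) (r - 1).
   The Frobenius number of H(Q_oo) is max_j s_j - m, and s_j <= r (m - 1).  So
   symmetry forces s_j = r (m - 1) for some j, that is j lambda_i = -1 mod m for
   all i, and all the lambda_i are equal; then H(Q_oo) is generated by m and r,
   and comparing q^2 + 1 + 2 g q with q^2 r + 1 gives m = q + 1. *)

Require Import Defs.
From mathcomp Require Import all_boot all_order all_algebra.
From mathcomp Require Import boolp classical_sets functions cardinality fsbigop.
From mathcomp Require Import separable finfield.
From mathcomp Require Import ring zify.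

Set Implicit Arguments.
Unset Strict Implicit.
Unset Printing Implicit Defensive.

Import Order.TTheory GRing.Theory Num.Theory.
Local Open Scope classical_set_scope.
Local Open Scope ring_scope.

(** * Existence of places *)

(** Places are bare valuation rings, so two devices carry the proof. Places are produced by
    Chevalley's extension theorem: a function w with no pole outside Q_oo must be integral over
    K[x], since otherwise K[x][1/w] would extend to a place that omits w. Orders are read from
    expansions t^n u, where the exponent n is found before the place is known: over infinity and
    over each alpha_i, a Bezout relation builds one parameter t from x and y, and the terms c_j(x)
    y^j have orders distinct modulo m, so the least order wins. Places with the same exponents
    coincide, which gives at once the uniqueness of the place over a center. The genus being a
    maximum over all divisors, an upper bound is required for each of them. It comes from products
    of functions x - a: each has a pole of order m at Q_oo and zeros of total order at most m, so
    poles off Q_oo can be moved to Q_oo without raising the degree. Rational points enter only as a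
    cardinal: maximality and the Castle condition prescribe the size of the same set, and equating
    the two sizes leaves (r - 1) q^2 = (m - 1) (r - 1) q. *)

Section Subring.
Variables (F : fieldType) (A : set F) (hA : subring_closed [in A]).

Lemma sr1 : A 1. Proof. by case: hA => /set_mem. Qed.

Lemma srB a b : A a -> A b -> A (a - b).
Proof. by case: hA => _ h _ /mem_set ha /mem_set hb; apply/set_mem/h. Qed.

Lemma srM a b : A a -> A b -> A (a * b).
Proof. by case: hA => _ _ h /mem_set ha /mem_set hb; apply/set_mem/h. Qed.

Lemma sr0 : A 0. Proof. by rewrite -(subrr 1); apply: srB; exact: sr1. Qed.

Lemma srN a : A a -> A (- a).
Proof. by move=> ha; rewrite -sub0r; apply: srB => //; exact: sr0. Qed.

Lemma srD a b : A a -> A b -> A (a + b).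
Proof. by move=> ha hb; rewrite -(opprK b); apply: srB => //; exact: srN. Qed.

Lemma srX a n : A a -> A (a ^+ n).
Proof.
by move=> ha; elim: n => [|n IHn]; [exact: sr1 | rewrite exprS; exact: srM].
Qed.

Lemma sr_sum I (s : seq I) (P : pred I) (f : I -> F) :
  (forall i, P i -> A (f i)) -> A (\sum_(i <- s | P i) f i).
Proof. by move=> h; elim/big_ind: _ => //; [exact: sr0 | exact: srD]. Qed.

Lemma sr_prod I (s : seq I) (P : pred I) (f : I -> F) :
  (forall i, P i -> A (f i)) -> A (\prod_(i <- s | P i) f i).
Proof. by move=> h; elim/big_ind: _ => //; [exact: sr1 | exact: srM]. Qed.

Lemma sr_horner (p : {poly F}) a : (forall i, A p`_i) -> A a -> A p.[a].
Proof.
move=> hp ha; rewrite horner_coef; apply: sr_sum => i _.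
by apply: srM => //; exact: srX.
Qed.

End Subring.

Lemma subring_closedP (F : fieldType) (A : set F) :
  A 1 -> (forall a b, A a -> A b -> A (a - b)) ->
  (forall a b, A a -> A b -> A (a * b)) -> subring_closed [in A].
Proof.
move=> h1 hB hM; split; first exact/mem_set.
- by move=> a b /set_mem ha /set_mem hb; apply/mem_set/hB.
- by move=> a b /set_mem ha /set_mem hb; apply/mem_set/hM.
Qed.

Section Divring.
Variables (F : fieldType) (E : set F) (hE : divring_closed [in E]).

Lemma dr_V a : E a -> E a^-1.
Proof.
case: hE => h1 _ h /mem_set ha.
by have := h _ _ h1 ha; rewrite div1r => /set_mem.
Qed.

Lemma dr_sr : subring_closed [in E].
Proof.
case: hE => h1 hB hD; split=> // a b ha hb.
by rewrite -[b]invrK; apply: hD => //; apply/mem_set/dr_V/set_mem.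
Qed.

Lemma dr_div a b : E a -> E b -> E (a / b).
Proof. by move=> ha /dr_V; apply: srM => //; exact: dr_sr. Qed.

Lemma dr_Xz a (n : int) : E a -> E (a ^ n).
Proof.
case: n => n ha; first by apply: srX => //; exact: dr_sr.
by rewrite NegzE -exprnN; apply: dr_V; apply: srX => //; exact: dr_sr.
Qed.

End Divring.

(* The domination step of Chevalley's extension theorem: a subring of E that is
   maximal among those containing A but not z is a valuation ring. *)
Section Chevalley.
Variables (F : fieldType) (k E A : set F) (z : F).
Hypotheses (hE : divring_closed [in E]) (hA : subring_closed [in A]).
Hypotheses (kA : k `<=` A) (AE : A `<=` E) (Ez : E z) (Nz : ~ A z).
Hypothesis Vz : A z^-1.

Let good (B : set F) :=
  [/\ subring_closed [in B], A `<=` B, B `<=` E & ~ B z].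

Let z_neq0 : z != 0.
Proof. by apply/eqP => z0; apply: Nz; rewrite z0; exact: sr0. Qed.

Lemma exists_maximal_subring :
  exists B, good B /\ forall C, good C -> B `<=` C -> C `<=` B.
Proof.
have gA : good A by split.
pose P := [set B : set F | B = set0 \/ good B].
have [G GP Gtot|B [PB Bmax]] := @Zorn_bigcup F P.
  have [[B0 [GB0 gB0]]|Gn] := pselect (exists B, G B /\ good B); last first.
    left; apply/seteqP; split=> // a [B GB Ba].
    case: (GP _ GB) => [B0|gB]; first by move: Ba; rewrite B0.
    by case: Gn; exists B.
  have gG B a : G B -> B a -> good B.
    by move=> GB Ba; case: (GP _ GB) => // B0'; move: Ba; rewrite B0'.
  have pair a b : (\bigcup_(X in G) X) a -> (\bigcup_(X in G) X) b ->
      exists B, [/\ G B, good B, B a & B b].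
    move=> [B GB Ba] [C GC Cb].
    have [BC|CB] := Gtot _ _ GB GC.
      by exists C; split=> //; [exact: (gG _ b) | exact: BC].
    by exists B; split=> //; [exact: (gG _ a) | exact: CB].
  right; split.
  - apply: subring_closedP.
    + by exists B0 => //; case: gB0 => h _ _ _; exact: sr1.
    + move=> a b /pair h /h [B [GB [hB _ _ _] Ba Bb]].
      by exists B => //; exact: srB.
    + move=> a b /pair h /h [B [GB [hB _ _ _] Ba Bb]].
      by exists B => //; exact: srM.
  - by move=> a Aa; exists B0 => //; case: gB0 => _ h _ _; exact: h.
  - by move=> a [B GB Ba]; have [_ _ h _] := gG _ _ GB Ba; exact: h.
  - by move=> [B GB Bz]; have [_ _ _] := gG _ _ GB Bz.
have NB C : good C -> B `<=` C -> C `<=` B.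
  move=> gC BC; apply: contrapT => CB.
  by apply: (Bmax C); [split|right].
case: PB => [B0|gB]; last by exists B.
have := NB A gA; rewrite B0 => /(_ (@sub0set _ _)) /(_ _ (sr1 hA)).
by [].
Qed.

Let adjoin (B : set F) (w : F) : set F :=
  [set a | exists2 p : {poly F}, (forall i, B p`_i) & a = p.[w]].

Let adjoin_subring B w : subring_closed [in B] ->
  subring_closed [in adjoin B w].
Proof.
move=> hB; apply: subring_closedP.
- exists 1; last by rewrite hornerC.
  by move=> i; rewrite coef1; case: (_ == _); [exact: sr1 | exact: sr0].
- move=> a b [p hp ->] [p' hp' ->]; exists (p - p'); last by rewrite hornerD hornerN.
  by move=> i; rewrite coefB; exact: srB.
- move=> a b [p hp ->] [p' hp' ->]; exists (p * p'); last by rewrite hornerM.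
  by move=> i; rewrite coefM; apply: sr_sum => // j _; exact: srM.
Qed.

Let adjoin_sub B w : subring_closed [in B] -> B `<=` adjoin B w.
Proof.
move=> hB a Ba; exists a%:P; last by rewrite hornerC.
by move=> i; rewrite coefC; case: (_ == _) => //; exact: sr0.
Qed.

Let adjoin_gen B w : subring_closed [in B] -> adjoin B w w.
Proof.
move=> hB; exists 'X; last by rewrite hornerX.
by move=> i; rewrite coefX; case: (_ == _); [exact: sr1 | exact: sr0].
Qed.

Section Max.
Variables (B : set F).
Hypotheses (gB : good B) (Bmax : forall C, good C -> B `<=` C -> C `<=` B).

Let hB : subring_closed [in B]. Proof. by case: gB. Qed.

Let BVz : B z^-1. Proof. by case: gB => _ h _ _; exact: h. Qed.

Let max_adjoin w : E w -> ~ B w -> adjoin B w z.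
Proof.
move=> Ew NBw; apply: contrapT => Nad.
apply: NBw; apply: (Bmax (C := adjoin B w)); last exact: adjoin_gen.
- split=> //; first exact: adjoin_subring.
  + by case: gB => _ h _ _ a /h; exact: adjoin_sub.
  + move=> a [p hp ->]; apply: sr_horner => //; first exact: dr_sr.
    by case: gB => _ _ h _ i; exact/h.
- exact: adjoin_sub.
Qed.

(** If the inverse of u = 1 - b/z were outside [B], maximality would give z = p(1/u) with p over
    [B]. Multiplying by u^N with N the size of p, and writing u^N = 1 - d/z, gives z - d in [B],
    hence z in [B]. *)
Let unitB b : B b -> b / z <> 1 -> B (1 - b / z)^-1.
Proof.
move=> Bb b1; have u0 : 1 - b / z != 0.
  by rewrite subr_eq0 eq_sym; exact/eqP.
have Bu : B (1 - b / z) by apply: srB => //; [exact: sr1 | exact: srM].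
apply: contrapT => NBu.
have Eu : E (1 - b / z)^-1 by apply: dr_V => //; case: gB => _ _ h _; exact: h.
have [p hp zE] := max_adjoin Eu NBu.
pose u := 1 - b / z; have Nu : u != 0 by [].
have [c Bc uc] : exists2 c, B c & u ^+ (size p) * z = c.
  exists (u ^+ (size p) * z) => //.
  rewrite {1}zE -/u horner_coef mulr_sumr; apply: sr_sum => // i _.
  rewrite mulrCA exprVn; apply: srM => //.
  have -> : u ^+ size p / u ^+ i = u ^+ (size p - i).
    by rewrite expfB_cond // (negPf Nu) /= add0n ltnW.
  exact: srX.
have [d Bd ud] : exists2 d, B d & u ^+ (size p) = 1 - d / z.
  elim: (size p) => [|n [d Bd hd]]; first by exists 0; [exact: sr0 | rewrite mul0r subr0].
  exists (b + d - b * d / z).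
    apply: srB => //; first exact: srD.
    by rewrite -mulrA mulrCA; do ?[apply: srM => //].
  by rewrite exprS hd /u; field.
case: gB => _ _ _; apply.
have -> : z = c + d.
  by move: uc; rewrite ud mulrBl mul1r divfK // => <-; rewrite subrK.
exact: srD.
Qed.

(* Two relations 1 = p(w) and 1 = q(1/w) with coefficients in B/z, of minimal
   degrees, would allow to lower the larger of these degrees. *)
Let rel (w : F) (n : nat) := exists2 c : nat -> F,
  (forall i, B (c i)) & \sum_(i < n.+1) c i / z * w ^+ i = 1.

Let rel_adjoin w : adjoin B w z -> exists n, rel w n.
Proof.
move=> [p hp zE]; exists (size p); exists (fun i => p`_i) => //.
rewrite big_ord_recr /= nth_default // !mul0r addr0.
transitivity (p.[w] / z); last by rewrite -zE divff.
by rewrite horner_coef mulr_suml; apply: eq_bigr => i _; rewrite mulrAC.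
Qed.

Let rel0 w : ~ rel w 0.
Proof.
move=> [c Bc]; rewrite big_ord1 expr0 mulr1 => c1.
case: gB => _ _ _; apply; suff -> : z = c 0%N by [].
by rewrite -[c 0%N](divfK z_neq0) c1 mul1r.
Qed.

(** With its constant term moved to the other side, the relation in 1/w has a unit u of [B] on that
    side. Multiplied by w^(n+1)/u it expresses w^(n+1) by the powers w^(n-i), whose exponents are
    nonnegative because l <= n; this replaces the top term of the relation in w. *)
Let rel_lower w n l : w != 0 -> (l <= n)%N -> rel w n.+1 -> rel w^-1 l.+1 -> rel w n.
Proof.
move=> w0 ln [c Bc c1] [d Bd].
rewrite big_ord_recl expr0 mulr1 /= => d1.
pose u := 1 - d 0%N / z.
have [du|du] := pselect (d 0%N / z = 1).
  case: (@rel0 w); exists (fun=> d 0%N) => //.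
  by rewrite big_ord1 expr0 mulr1.
have Bu : B u^-1 by exact: unitB.
have u0 : u != 0 by rewrite subr_eq0 eq_sym; exact/eqP.
have {}d1 : \sum_(i < l.+1) d i.+1 / z * w^-1 ^+ i.+1 = u.
  by rewrite /u -d1 addrC addKr.
have wE : w ^+ n.+1 = \sum_(i < l.+1) (u^-1 * d i.+1) / z * w ^+ (n - i).
  rewrite -[LHS]mul1r -(mulVf u0) -{2}d1 -mulrA mulr_suml mulr_sumr.
  apply: eq_bigr => i _.
  rewrite -!mulrA; congr (_ * (_ * (_ * _))).
  have ile : (i <= n)%N by rewrite (leq_trans _ ln) // -ltnS.
  rewrite exprVn -(subnK (_ : i.+1 <= n.+1)%N) // exprD subSS.
  by rewrite mulrCA mulVf ?expf_neq0 // mulr1.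
have Bz1 : B (c n.+1 / z) by exact: srM.
pose e i := c i + \sum_(j < l.+1 | (n - j)%N == i) (c n.+1 / z * (u^-1 * d j.+1)).
exists e.
  move=> i; apply: srD => //; apply: sr_sum => // j _.
  by do 2!apply: srM => //.
rewrite -[RHS]c1 [in RHS]big_ord_recr /= wE.
under eq_bigr do rewrite /e !mulrDl.
rewrite big_split /=; congr (_ + _).
rewrite mulr_sumr.
under eq_bigr => i _.
  rewrite mulr_suml mulr_suml big_mkcond /=.
  over.
rewrite exchange_big /=; apply: eq_bigr => j _.
have jn : (n - j < n.+1)%N by rewrite ltnS leq_subr.
rewrite (bigD1 (Ordinal jn)) //= eqxx big1 ?addr0.
  by rewrite !mulrA.
by move=> i; rewrite -val_eqE /= eq_sym => /negPf ->.
Qed.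

Lemma maximal_subring_valuation w : E w -> B w \/ B w^-1.
Proof.
move=> Ew; apply: contrapT => /not_orP[NBw NBw'].
have w0 : w != 0 by apply/eqP => w0; apply: NBw; rewrite w0; exact: sr0.
have [n rn] := rel_adjoin (max_adjoin Ew NBw).
have [l rl] := rel_adjoin (max_adjoin (dr_V hE Ew) NBw').
(* Descent on the sum of the two degrees; when the relation in 1/w is the longer one, the lowering
   applies with w and 1/w exchanged. *)
have [N] := ubnP (n + l)%N.
elim: N n l rn rl => // N IHN [|n] [|l] rn rl; try by case: (rel0 rn).
  by case: (rel0 rl).
move=> nl; have [ln|nl'] := leqP l n.
  by apply: (IHN _ _ (rel_lower w0 ln rn rl) rl); rewrite addSn ltnS in nl.
have rl' : rel w^-1 l.
  by apply: (rel_lower _ (ltnW nl') rl); rewrite ?invr_eq0 ?invrK.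
by apply: (IHN _ _ rn rl'); rewrite addnS ltnS in nl.
Qed.

End Max.

(** Used twice: with [A] = K[x][1/w] it gives a non-integral w a pole where x has none, and with [A]
    = K[x] and z = 1/(x - a) it gives a place where x - a vanishes. Nonconstant elements of [A] make
    the inclusion of [k] in [O] strict. *)
Lemma exists_place : ~ (A `<=` k) ->
  exists O, [/\ is_place k E O, A `<=` O & ~ O z].
Proof.
move=> Ak; have [B [gB Bmax]] := exists_maximal_subring.
have [hB AB BE NBz] := gB.
exists B; split=> //; split=> //.
- split; first by move=> a /kA /AB.
  by move=> Bk; apply: Ak => a /AB /Bk.
- by split=> // EB; apply/NBz/EB.
- by move=> w Ew; exact: maximal_subring_valuation.
Qed.

End Chevalley.

(** * Places and Riemann-Roch spaces *)

Section Place.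
Variables (K F : fieldType) (iota : {rmorphism K -> F}) (E O : set F).
Hypotheses (hE : divring_closed [in E]) (hO : is_place (range iota) E O).

Let M := maxideal O.

Lemma place_subring : subring_closed [in O]. Proof. by case: hO. Qed.
Let sO := place_subring.

Lemma place_const c : O (iota c).
Proof. by case: hO => _ [h _] _ _; apply: h; exists c. Qed.

Lemma place_sub : O `<=` E. Proof. by case: hO => _ _ [h _] _. Qed.

Lemma place_total z : E z -> O z \/ O z^-1.
Proof. by case: hO => _ _ _; apply. Qed.

Lemma maxidealP z : M z <-> O z /\ (z = 0 \/ ~ O z^-1).
Proof.
split=> [[Oz Nu]|[Oz h]].
  split=> //; have [->|z0] := eqVneq z 0; [by left | right => Oz'].
  by apply: Nu; split.
by split=> // -[_ z0 Oz']; case: h => // z0'; rewrite z0' eqxx in z0.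
Qed.

Lemma maxideal_sub z : M z -> O z. Proof. by case. Qed.

Lemma maxideal0 : M 0.
Proof. by apply/maxidealP; split; [exact: sr0 | left]. Qed.

Lemma maxideal1N : ~ M 1.
Proof.
move=> /maxidealP[_ [/eqP|]]; first by rewrite oner_eq0.
by rewrite invr1; apply; exact: sr1.
Qed.

Lemma maxidealM a b : O a -> M b -> M (a * b).
Proof.
move=> Oa /maxidealP[Ob hb]; apply/maxidealP; split; first exact: srM.
have [->|ab0] := eqVneq (a * b) 0; first by left.
move: (ab0); rewrite mulf_eq0 negb_or => /andP[a0 b0].
case: hb => [b0'|NOb]; first by rewrite b0' eqxx in b0.
right=> Oab; apply: NOb.
have -> : b^-1 = a * (a * b)^-1 by rewrite invfM mulrA divff ?mul1r.
exact: srM.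
Qed.

Lemma maxidealN a : M a -> M (- a).
Proof.
move=> Ma; rewrite -mulN1r; apply: maxidealM => //.
by apply: srN => //; exact: sr1.
Qed.

Lemma maxidealB a b : M a -> M b -> M (a - b).
Proof.
move=> Ma Mb.
have [->|a0] := eqVneq a 0; first by rewrite sub0r; exact: maxidealN.
have [->|b0] := eqVneq b 0; first by rewrite subr0.
have Ea : E a by apply/place_sub/maxideal_sub.
have Eb : E b by apply/place_sub/maxideal_sub.
case: (place_total (dr_div hE Ea Eb)) => h.
  have -> : a - b = (a / b - 1) * b by rewrite mulrBl divfK ?mul1r.
  by apply: maxidealM => //; apply: srB => //; exact: sr1.
have -> : a - b = (1 - (a / b)^-1) * a by rewrite invf_div mulrBl divfK ?mul1r.
by apply: maxidealM => //; apply: srB => //; exact: sr1.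
Qed.

Lemma maxidealD a b : M a -> M b -> M (a + b).
Proof. by move=> Ma Mb; rewrite -(opprK b); apply/maxidealB/maxidealN. Qed.

Lemma maxideal_sum I (s : seq I) (P : pred I) (f : I -> F) :
  (forall i, P i -> M (f i)) -> M (\sum_(i <- s | P i) f i).
Proof. by move=> h; elim/big_ind: _ => //; [exact: maxideal0 | exact: maxidealD]. Qed.

Lemma maxideal_inv z : E z -> ~ O z -> M z^-1.
Proof.
move=> Ez NOz; apply/maxidealP; rewrite invrK.
by split; [case: (place_total Ez) | right].
Qed.

Lemma maxideal_prime a b : O a -> O b -> M (a * b) -> M a \/ M b.
Proof.
move=> Oa Ob Mab; have [/= Ma|NMa] := pselect (M a); [by left | right].
have /not_andP[//|/not_orP[/eqP a0 /contrapT Oa']] :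
  ~ (O a /\ (a = 0 \/ ~ O a^-1)) by move/maxidealP.
by rewrite -(mulKf a0 b); exact: maxidealM.
Qed.

Lemma maxideal_prod I (s : seq I) (f : I -> F) :
  (forall i, O (f i)) -> M (\prod_(i <- s) f i) -> exists i, M (f i).
Proof.
move=> Of; elim: s => [|i s IHs]; first by rewrite big_nil => /maxideal1N.
rewrite big_cons => /(maxideal_prime (Of i) (sr_prod sO s (fun i _ => Of i))).
by case=> [|/IHs //]; exists i.
Qed.

Lemma maxidealX a n : O a -> M (a ^+ n) -> M a.
Proof.
move=> Oa; elim: n => [/maxideal1N //|n IHn]; rewrite exprS.
by move=> /(maxideal_prime Oa (srX sO n Oa))[].
Qed.

Lemma place_root z n : E z -> (0 < n)%N -> O (z ^+ n) -> O z.
Proof.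
move=> Ez n0 Ozn; apply: contrapT => NOz.
have z0 : z != 0 by apply/eqP => z0; apply: NOz; rewrite z0; exact: sr0.
apply: maxideal1N; rewrite -(@divff _ (z ^+ n)) ?expf_neq0 //.
apply: maxidealM => //; rewrite -exprVn -(prednK n0) exprSr.
apply: maxidealM; last exact: maxideal_inv.
by apply: srX => //; exact/maxideal_sub/maxideal_inv.
Qed.

(** Carrying the residue as an explicit constant lets leading coefficients and the degree of a place
    be read off directly from an expansion. *)
Definition residue_unit (u : F) := exists2 c : K, c != 0 & M (u - iota c).
Let U1 := residue_unit.

Lemma residue_unit_place u : U1 u -> O u.
Proof.
move=> [c _ /maxideal_sub Mu]; rewrite -(subrK (iota c) u).
by apply: srD => //; exact: place_const.
Qed.

Lemma residue_unitNmax u : U1 u -> ~ M u.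
Proof.
move=> [c c0 Mu] Mu'; apply: maxideal1N.
have -> : 1 = iota c^-1 * (u - (u - iota c)).
  by rewrite opprB addrC subrK fmorphV mulVf ?fmorph_eq0.
by apply: maxidealM; [exact: place_const | exact: maxidealB].
Qed.

Lemma residue_unit_neq0 u : U1 u -> u != 0.
Proof. by move=> /residue_unitNmax h; apply/eqP => u0; apply: h; rewrite u0; exact: maxideal0. Qed.

Lemma residue_unit_inv_place u : U1 u -> O u^-1.
Proof.
move=> Uu; apply: contrapT => NOu; apply: (residue_unitNmax Uu).
by apply/maxidealP; split; [exact: residue_unit_place | right].
Qed.

Lemma residue_unitC c : c != 0 -> U1 (iota c).
Proof. by move=> c0; exists c => //; rewrite subrr; exact: maxideal0. Qed.

Lemma residue_unit1 : U1 1.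
Proof. by rewrite -(rmorph1 iota); apply: residue_unitC; exact: oner_neq0. Qed.

Lemma residue_unitM u v : U1 u -> U1 v -> U1 (u * v).
Proof.
move=> [c c0 Mu] Uv; have [d d0 Mv] := Uv; exists (c * d); first exact: mulf_neq0.
have -> : u * v - iota (c * d) = v * (u - iota c) + iota c * (v - iota d).
  by rewrite rmorphM; ring.
by apply: maxidealD; apply: maxidealM => //;
  [exact: residue_unit_place | exact: place_const].
Qed.

Lemma residue_unitV u : U1 u -> U1 u^-1.
Proof.
move=> Uu; have [c c0 Mu] := Uu; exists c^-1; first by rewrite invr_eq0.
have u0 := residue_unit_neq0 Uu.
have -> : u^-1 - iota c^-1 = - (iota c^-1 * u^-1) * (u - iota c).
  rewrite fmorphV; have : iota c != 0 by rewrite fmorph_eq0.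
  by move=> ?; field; apply/andP.
apply: maxidealM => //; apply: srN => //; apply: srM => //; first exact: place_const.
exact: residue_unit_inv_place.
Qed.

Lemma residue_unitX u n : U1 u -> U1 (u ^+ n).
Proof.
move=> Uu; elim: n => [|n IHn]; first exact: residue_unit1.
by rewrite exprS; exact: residue_unitM.
Qed.

Lemma residue_unitXz u (n : int) : U1 u -> U1 (u ^ n).
Proof.
move=> Uu; case: n => n; first exact: residue_unitX.
by rewrite NegzE -exprnN; apply/residue_unitV/residue_unitX.
Qed.

Lemma residue_unitD u a : U1 u -> M a -> U1 (u + a).
Proof.
by move=> [c c0 Mu] Ma; exists c => //; rewrite addrAC; exact: maxidealD.
Qed.

(* t generates the maximal ideal, and the residue field is the field of
   constants. *)
Definition local_param (t : F) := [/\ M t, t != 0 &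
  forall z, E z -> z != 0 -> exists n u, residue_unit u /\ z = t ^ n * u].

Lemma maxideal_Xz t (n : int) : M t -> 0 < n -> M (t ^ n).
Proof.
case: n => // -[//|n] Mt _; change (M (t ^+ n.+1)); rewrite exprSr.
by apply: maxidealM => //; apply: srX => //; exact: maxideal_sub.
Qed.

Lemma place_Xz t (n : int) : M t -> 0 <= n -> O (t ^ n).
Proof. by case: n => // n Mt _; apply: srX => //; exact: maxideal_sub. Qed.

Lemma place_Xz_unit t (n : int) u : M t -> t != 0 -> U1 u ->
  O (t ^ n * u) <-> 0 <= n.
Proof.
move=> Mt t0 Uu; split=> [Oz|n0]; last first.
  by apply: srM => //; [exact: place_Xz | exact: residue_unit_place].
rewrite leNgt; apply/negP => n0; apply: maxideal1N.
have -> : 1 = (t ^ n * u * u^-1) * t ^ (- n).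
  by rewrite mulfK ?residue_unit_neq0 // -expfzDr // subrr.
apply: maxidealM; first by apply: srM => //; exact: residue_unit_inv_place.
by apply: maxideal_Xz => //; rewrite oppr_gt0.
Qed.

Section Param.
Variables (t : F) (ht : local_param t).
Let Mt : M t. Proof. by case: ht. Qed.
Let t0 : t != 0. Proof. by case: ht. Qed.

Lemma param_uniformizer : uniformizer O t.
Proof.
apply/seteqP; split=> z; last first.
  by move=> [u Ou <-]; rewrite mulrC; exact: maxidealM.
move=> Mz; have [->|z0] := eqVneq z 0.
  by exists 0; rewrite ?mulr0 //; exact: sr0.
have Oz := maxideal_sub Mz; case: ht => _ _ /(_ z (place_sub Oz) z0)[n [u [Uu zE]]].
exists (t ^ (n - 1) * u); last first.
  by rewrite mulrA -{1}(expr1z t) -expfzDr // addrC subrK.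
apply/place_Xz_unit => //; rewrite subr_ge0 -gtz0_ge1 lt_def.
have := Oz; rewrite {1}zE => /place_Xz_unit -> //; rewrite andbT.
apply/eqP => n0; move: Mz; rewrite zE n0 expr0z mul1r; exact: residue_unitNmax.
Qed.

(** [valuation] picks its exponent among all uniformizers t' and units, so an arbitrary such choice
    has to be compared with t. As t' = t a with a a unit, t^(n'-n) and its inverse both lie in [O],
    which forces n' = n. *)
Lemma valuation_param (n : int) u : U1 u -> valuation O (t ^ n * u) = n.
Proof.
move=> Uu; apply: xget_unique.
  exists t, u; split=> //; first exact: param_uniformizer.
  split; [exact: residue_unit_place | exact: residue_unit_neq0|].
  exact: residue_unit_inv_place.
move=> n' [t' [u' [ut' [Ou' u'0 Ou'V] E1]]].
have := param_uniformizer; rewrite /uniformizer ut' => MM.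
have [a Oa ta] : [set t * u | u in O] t'.
  by rewrite -MM; exists 1; rewrite ?mulr1 //; exact: sr1.
have [b Ob tb] : [set t' * u | u in O] t.
  by rewrite MM; exists 1; rewrite ?mulr1 //; exact: sr1.
have ab1 : a * b = 1 by apply: (mulfI t0); rewrite mulrA ta tb mulr1.
have a0 : a != 0 by apply/eqP => a0; move: ab1; rewrite a0 mul0r => /esym/eqP; rewrite oner_eq0.
have bE : a^-1 = b by rewrite -[LHS]mulr1 -ab1 mulKf.
have OaXz m : O (a ^ m).
  case: m => m; first by apply: srX.
  by rewrite NegzE -exprnN -exprVn bE; apply: srX.
have t'E : t ^ n' = t ^ n * (u * (a ^ n' * u')^-1).
  rewrite mulrA E1 -ta expfzMl -[t ^ n' * _ * _]mulrA mulfK //.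
  by rewrite mulf_neq0 // expfz_neq0.
have uE : u * (a ^ n' * u')^-1 = t ^ (n' - n).
  by rewrite expfzDr // t'E mulrC -mulrA mulrCA -expfzDr // subrr mulr1.
have O1 : O (t ^ (n' - n) * 1).
  rewrite mulr1 -uE; apply: srM => //; first exact: residue_unit_place.
  by rewrite invfM invr_expz; apply: srM.
have O2 : O (t ^ (n - n') * 1).
  rewrite mulr1 -opprB -invr_expz -uE invf_div; apply: srM => //; first exact: srM.
  exact: residue_unit_inv_place.
move/(place_Xz_unit _ Mt t0 residue_unit1): O1 => O1.
move/(place_Xz_unit _ Mt t0 residue_unit1): O2 => O2.
by apply/eqP; rewrite eq_le -subr_ge0 O2 -subr_ge0 O1.
Qed.

Lemma valuationP z : E z -> z != 0 ->
  exists2 u, U1 u & z = t ^ (valuation O z) * u.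
Proof.
move=> Ez z0; case: ht => _ _ /(_ z Ez z0)[n [u [Uu zE]]].
by exists u => //; rewrite {2}zE valuation_param.
Qed.

End Param.

Section Valuation.
Hypothesis ex_param : exists t, local_param t.

Let v := valuation O.

Lemma valuationM z w : E z -> E w -> z != 0 -> w != 0 -> v (z * w) = v z + v w.
Proof.
case: ex_param => t ht Ez Ew z0 w0.
have [u Uu zE] := valuationP ht Ez z0; have [u' Uu' wE] := valuationP ht Ew w0.
rewrite {1}zE {1}wE mulrACA -expfzDr; last by case: ht.
by rewrite /v (valuation_param ht) //; exact: residue_unitM.
Qed.

Lemma valuation_ru u : U1 u -> v u = 0.
Proof.
case: ex_param => t ht Uu; rewrite -[u]mul1r -(expr0z t).
exact: valuation_param.
Qed.

Lemma valuation1 : v 1 = 0. Proof. exact: valuation_ru residue_unit1. Qed.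

Lemma valuationX z n : E z -> z != 0 -> v (z ^+ n) = v z *+ n.
Proof.
move=> Ez z0; elim: n => [|n IHn]; first by rewrite expr0 valuation1.
rewrite exprS mulrS valuationM ?IHn ?expf_neq0 //.
by apply: srX => //; exact: dr_sr.
Qed.

Lemma valuationV z : E z -> z != 0 -> v z^-1 = - v z.
Proof.
move=> Ez z0; have z0' : z^-1 != 0 by rewrite invr_eq0.
have := valuationM (dr_V hE Ez) Ez z0' z0; rewrite mulVf // valuation1.
by move/esym/eqP; rewrite addr_eq0 => /eqP.
Qed.

Lemma valuation_prod I (s : seq I) (f : I -> F) :
  (forall i, E (f i)) -> (forall i, f i != 0) ->
  v (\prod_(i <- s) f i) = \sum_(i <- s) v (f i).
Proof.
move=> Ef f0; elim: s => [|i s IHs]; first by rewrite !big_nil valuation1.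
rewrite !big_cons valuationM ?IHs //; first by apply: sr_prod => //; exact: dr_sr.
by elim/big_ind: _ => [||i' _]; [exact: oner_neq0 | exact: mulf_neq0 | exact: f0].
Qed.

Lemma valuation_ge0 z : E z -> z != 0 -> (0 <= v z) <-> O z.
Proof.
case: ex_param => t ht Ez z0; have [u Uu zE] := valuationP ht Ez z0.
by rewrite {2}zE; case: ht => Mt t0 _; rewrite place_Xz_unit.
Qed.

Lemma valuation_gt0 z : E z -> z != 0 -> (0 < v z) <-> M z.
Proof.
case: ex_param => t ht Ez z0; have [u Uu zE] := valuationP ht Ez z0.
have [Mt t0 _] := ht; split=> [vz|Mz].
  rewrite zE mulrC; apply: maxidealM; last exact: maxideal_Xz.
  exact: residue_unit_place.
have /(valuation_ge0 Ez z0) : O z by exact: maxideal_sub.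
rewrite le_eqVlt => /predU1P[vz|//]; exfalso.
by apply: (residue_unitNmax Uu); move: Mz; rewrite zE -/v -vz expr0z mul1r.
Qed.

Definition val_ge (n : int) (z : F) := z != 0 -> n <= v z.

Lemma val_geP t n z : local_param t -> E z -> val_ge n z <-> O (z * t ^ (- n)).
Proof.
move=> ht Ez; have [Mt t0 _] := ht.
have [->|z0] := eqVneq z 0.
  by split=> [_|_]; [rewrite mul0r; exact: sr0 | rewrite /val_ge eqxx].
have [u Uu zE] := valuationP ht Ez z0.
have -> : z * t ^ (- n) = t ^ (v z - n) * u by rewrite {1}zE mulrAC -expfzDr.
rewrite place_Xz_unit // subr_ge0; split; first by apply.
by move=> h _.
Qed.

Lemma val_geB n z w : E z -> E w -> val_ge n z -> val_ge n w -> val_ge n (z - w).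
Proof.
case: ex_param => t ht Ez Ew /(val_geP _ ht Ez) hz /(val_geP _ ht Ew) hw.
apply/(val_geP _ ht); first by apply: srB => //; exact: dr_sr.
by rewrite mulrBl; exact: srB.
Qed.

Lemma val_geZ n c z : E z -> val_ge n z -> val_ge n (iota c * z).
Proof.
case: ex_param => t ht Ez /(val_geP _ ht Ez) hz.
apply/(val_geP _ ht).
  by apply: srM => //; [exact: dr_sr | exact/place_sub/place_const].
by rewrite -mulrA; apply: srM => //; exact: place_const.
Qed.

(** The constant is the residue of z/w, which cancels the leading term of z. This is the reason why
    allowing one more pole raises the dimension of a Riemann-Roch space by at most one. *)
Lemma val_ge_lead n z w : E z -> E w -> w != 0 -> v w = n -> val_ge n z ->
  exists c, val_ge (n + 1) (z - iota c * w).
Proof.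
move=> Ez Ew w0 vw vz; have [z0|z0] := eqVneq z 0.
  by exists 0; rewrite rmorph0 mul0r subr0 z0 /val_ge eqxx.
have Ezw c : E (z - iota c * w).
  apply: srB => //; first exact: dr_sr.
  by apply: srM => //; [exact: dr_sr | exact/place_sub/place_const].
case: ex_param => t ht; have [Mt t0 _] := ht.
have [u Uu zE] := valuationP ht Ez z0; have [u' Uu' wE] := valuationP ht Ew w0.
rewrite -/v vw in wE.
move: (vz z0); rewrite le_eqVlt => /predU1P[nz|]; last first.
  by rewrite -lezD1 => nz; exists 0; rewrite rmorph0 mul0r subr0.
have [c c0 Mu] := residue_unitM Uu (residue_unitV Uu').
exists c; case: (eqVneq (z - iota c * w) 0) => [->|zw0]; first by rewrite /val_ge eqxx.
have zwE : z - iota c * w = w * (u * u'^-1 - iota c).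
  rewrite mulrBr [w * iota c]mulrC; congr (_ - _).
  rewrite {1}zE -/v -nz {1}wE; have := residue_unit_neq0 Uu'.
  by move=> ?; field.
move=> _; rewrite zwE; rewrite zwE mulf_eq0 negb_or in zw0.
have [_ uu0] := andP zw0.
have Euu : E (u * u'^-1 - iota c) by exact/place_sub/maxideal_sub.
by rewrite valuationM // vw lerD2l -gtz0_ge1; apply/(valuation_gt0 Euu).
Qed.

End Valuation.
End Place.

(** * Dimension of quotients over the constant field *)

Section Dimension.
Variables (K F : fieldType) (iota : {rmorphism K -> F}).
Local Notation k := (range iota).

Definition subspace (V : set F) := [/\ V 0, forall a b, V a -> V b -> V (a - b)
  & forall c a, V a -> V (iota c * a)].

Lemma subspaceN V a : subspace V -> V a -> V (- a).
Proof. by case=> V0 VB _ Va; rewrite -sub0r; exact: VB. Qed.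

Lemma subspaceD V a b : subspace V -> V a -> V b -> V (a + b).
Proof.
by move=> sV Va Vb; rewrite -(opprK b); case: (sV) => _ VB _; apply: VB => //; exact: subspaceN.
Qed.

Lemma subspace_sum V I (s : seq I) (P : pred I) (f : I -> F) : subspace V ->
  (forall i, P i -> V (f i)) -> V (\sum_(i <- s | P i) f i).
Proof.
move=> sV h; elim/big_ind: _ => //; first by case: sV.
by move=> a b; exact: subspaceD.
Qed.

Lemma subspace0 : subspace [set 0].
Proof.
split=> [|a b|c a] //=; first by move=> -> ->; rewrite subrr.
by move=> ->; rewrite mulr0.
Qed.

Lemma const_divring : divring_closed [in k].
Proof.
split; first by apply/mem_set; exists 1; rewrite ?rmorph1.
- move=> _ _ /set_mem[a _ <-] /set_mem[b _ <-]; apply/mem_set.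
  by exists (a - b); rewrite ?rmorphB.
- move=> _ _ /set_mem[a _ <-] /set_mem[b _ <-]; apply/mem_set.
  by exists (a / b); rewrite ?rmorphM ?fmorphV.
Qed.
Let sk := dr_sr const_divring.

(** Coordinates modulo [W] are unique, so the two matrices expressing each basis in the other
    satisfy A B = 1, and the rank bounds n by n'. *)
Lemma has_dim_le V W n n' : subspace W ->
  has_dim k V W n -> has_dim k V W n' -> (n <= n')%N.
Proof.
move=> sW [e [Ve he]] [e' [Ve' he']].
have /choice[A hA] i : exists c : {ffun 'I_n' -> F}, (forall j, k (c j)) /\
    W (e i - \sum_(j < n') c j * e' j).
  by have [c [hc _]] := he' _ (Ve i); exists c.
have /choice[B hB] i : exists c : {ffun 'I_n -> F}, (forall j, k (c j)) /\
    W (e' i - \sum_(j < n) c j * e j).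
  by have [c [hc _]] := he _ (Ve' i); exists c.
apply: (@mulmx1_min _ _ _ (\matrix_(i, j) A i j) (\matrix_(i, j) B i j)).
apply/matrixP => i l; rewrite !mxE.
under eq_bigr do rewrite !mxE.
have [c [_ cU]] := he _ (Ve i).
have E1 : c = [ffun l => \sum_j A i j * B j l].
  apply: cU; split.
    move=> a; rewrite ffunE; apply: sr_sum => // j _.
    by apply: srM => //; [case: (hA i) | case: (hB j)].
  have -> : e i - \sum_(a < n) [ffun l => \sum_j A i j * B j l] a * e a
    = (e i - \sum_j A i j * e' j) +
      \sum_j A i j * (e' j - \sum_a B j a * e a).
    under eq_bigr do rewrite ffunE mulr_suml.
    under [X in _ = _ + X]eq_bigr do rewrite mulrBr.
    rewrite sumrB addrA subrK exchange_big /=; congr (_ - _).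
    by apply: eq_bigr => j _; rewrite mulr_sumr; apply: eq_bigr => a _; rewrite mulrA.
  apply: subspaceD => //; first by case: (hA i).
  apply: subspace_sum => // j _; case: (hA i) => /(_ j)[a _ <-] _.
  by case: sW => _ _; apply; case: (hB j).
have E2 : c = [ffun l => (i == l)%:R].
  apply: cU; split.
    by move=> a; rewrite ffunE; exists (i == a)%:R; rewrite ?rmorph_nat.
  under eq_bigr do rewrite ffunE.
  rewrite (bigD1 i) //= eqxx mul1r big1 ?addr0 ?subrr; first by case: sW.
  by move=> a /negPf; rewrite eq_sym => ->; rewrite mul0r.
by have := congr1 (fun f : {ffun 'I_n -> F} => f l) (etrans (esym E1) E2); rewrite !ffunE.
Qed.

Lemma has_dim_inj V W n n' : subspace W ->
  has_dim k V W n -> has_dim k V W n' -> n = n'.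
Proof.
move=> sW h h'; apply/eqP; rewrite eqn_leq.
by rewrite (has_dim_le sW h h') (has_dim_le sW h' h).
Qed.

Lemma dimE V W n : subspace W -> has_dim k V W n -> Defs.dim k V W = n.
Proof.
by move=> sW h; apply: xget_unique => // n' /= h'; exact: has_dim_inj h' h.
Qed.

Lemma has_dim0 : has_dim k [set 0] [set 0] 0.
Proof.
exists (fun=> 0); split=> // v ->; exists [ffun=> 0]; split.
  by split=> [[]//|]; rewrite big_ord0 subr0.
by move=> c _; apply/ffunP => -[].
Qed.

Lemma has_dim_step V W w n : subspace V -> V `<=` W -> W w -> ~ V w ->
  (forall z, W z -> exists c, V (z - iota c * w)) ->
  has_dim k V [set 0] n -> has_dim k W [set 0] n.+1.
Proof.
move=> sV VW Ww NVw hW [e [Ve he]].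
(* The new vector w takes index 0 and [unlift] shifts the old basis by one. *)
exists (fun i => if unlift ord0 i is Some j then e j else w); split.
  by move=> i; case: unliftP => [j _|_] //; apply/VW.
move=> z Wz; have [c Vzc] := hW z Wz.
have [d [[kd dz] dU]] := he _ Vzc.
have sumE (b : {ffun 'I_n.+1 -> F}) : \sum_(i < n.+1) b i *
      (if unlift ord0 i is Some j then e j else w)
    = b ord0 * w + \sum_(j < n) b (lift ord0 j) * e j.
  rewrite big_ord_recl unlift_none; congr (_ + _).
  by apply: eq_bigr => j _; rewrite liftK.
exists [ffun i => if unlift ord0 i is Some j then d j else iota c]; split.
  split.
    by move=> i; rewrite ffunE; case: unliftP => [j _|_]; [exact: kd | exists c].
  rewrite sumE ffunE unlift_none opprD addrA.
  by under eq_bigr do rewrite ffunE liftK.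
move=> b [kb]; rewrite sumE opprD addrA => zb.
have [b0 _ b0E] := kb ord0.
have sumV : V (z - iota b0 * w).
  rewrite b0E; move: zb => /eqP; rewrite subr_eq0 => /eqP ->.
  apply: subspace_sum => // j _; have [a _ <-] := kb (lift ord0 j).
  by case: sV => _ _; apply.
(* Two different coordinates along w would put (c - b0) w, hence w itself, into [V]. *)
have cb0 : c = b0.
  apply: contrapT => cb0; apply: NVw.
  have -> : w = iota (c - b0)^-1 * ((z - iota b0 * w) - (z - iota c * w)).
    have -> : (z - iota b0 * w) - (z - iota c * w) = iota (c - b0) * w.
      by rewrite rmorphB; ring.
    rewrite mulrA -rmorphM mulVf ?rmorph1 ?mul1r //.
    by rewrite subr_eq0; apply/eqP.
  by case: sV => _ VB; apply; exact: VB.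
have -> : d = [ffun j => b (lift ord0 j)].
  apply: dU; split; first by move=> j; rewrite ffunE.
  by rewrite cb0 b0E; under eq_bigr do rewrite ffunE.
apply/ffunP => i; rewrite ffunE; case: unliftP => [j ->|->]; first by rewrite ffunE.
by rewrite cb0 b0E.
Qed.

Lemma has_dim_scale h V W n : h != 0 -> (forall z, W z <-> V (h * z)) ->
  has_dim k V [set 0] n -> has_dim k W [set 0] n.
Proof.
move=> h0 WV [e [Ve he]]; exists (fun i => h^-1 * e i); split.
  by move=> i; apply/WV; rewrite mulVKf.
move=> z /WV /he [c [[kc zc] cU]].
have sumE (b : {ffun 'I_n -> F}) :
    \sum_(i < n) b i * (h^-1 * e i) = h^-1 * \sum_(i < n) b i * e i.
  by rewrite mulr_sumr; apply: eq_bigr => i _; rewrite mulrCA.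
exists c; split=> [|b [kb zb]].
  split=> //; rewrite sumE -(mulKf h0 z) -mulrBr.
  by rewrite /= in zc *; rewrite zc mulr0.
apply: cU; split=> //; move: zb; rewrite sumE /= => /eqP.
by rewrite subr_eq0 => /eqP ->; rewrite mulVKf // subrr.
Qed.

End Dimension.

(** * Riemann's inequality and the genus *)

Section RiemannRoch.
Variables (K F : fieldType) (iota : {rmorphism K -> F}) (E : set F).
Hypotheses (hE : divring_closed [in E]) (kE : range iota `<=` E).
Hypothesis ex_param : forall O, is_place (range iota) E O ->
  exists t, local_param iota E O t.
Local Notation k := (range iota).
Local Notation RR := (RRspace k E).

(** Every unit has a constant residue, so 1 spans the residue field; the degree of a divisor is then
    the plain sum of its coefficients. *)
Lemma place_degree1 O : is_place k E O -> place_degree k O = 1%N.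
Proof.
move=> hO; have [t ht] := ex_param hO.
have sM : subspace iota (maxideal O).
  split; first exact: (maxideal0 hO).
  - by move=> a b; exact: (maxidealB hE hO).
  - by move=> c a; apply: (maxidealM hO); exact: (place_const hO).
apply: dimE => //; exists (fun=> 1); split.
  by move=> _; apply: sr1; exact: (place_subring hO).
move=> v Ov; have [c Mc] : exists c, maxideal O (v - iota c).
  have [->|v0] := eqVneq v 0; first by exists 0; rewrite rmorph0 subr0; exact: (maxideal0 hO).
  have Ev := place_sub hO Ov.
  have /(valuation_ge0 hE hO (ex_param hO) Ev v0) := Ov.
  rewrite le_eqVlt => /predU1P[v0'|]; last first.
    move/(valuation_gt0 hE hO (ex_param hO) Ev v0) => Mv.
    by exists 0; rewrite rmorph0 subr0.
  have [u [c _ Mu] vE] := valuationP hE hO ht Ev v0.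
  by exists c; rewrite vE -v0' expr0z mul1r.
exists [ffun=> iota c]; split.
  split; first by move=> i; rewrite ffunE; exists c.
  by rewrite big_ord1 ffunE mulr1.
move=> d [kd]; rewrite big_ord1 mulr1 => Md; apply/ffunP => i.
rewrite ffunE ord1; have [b _ bE] := kd ord0; rewrite -bE in Md *.
congr (iota _); apply: contrapT => cb.
apply: (maxideal1N hO).
have -> : 1 = iota (b - c)^-1 * ((v - iota c) - (v - iota b)).
  have -> : (v - iota c) - (v - iota b) = iota (b - c) by rewrite rmorphB; ring.
  rewrite -rmorphM mulVf ?rmorph1 // subr_eq0.
  by apply/eqP => bc; apply: cb.
by apply: (maxidealM hO); [exact: (place_const hO) | exact: (maxidealB hE hO)].
Qed.

Lemma RRspaceP D z : RR D z <->
  E z /\ forall P, is_place k E P -> val_ge P (- D P) z.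
Proof.
split=> -[Ez h]; split=> //; first by move=> P hP z0; exact: h.
by move=> z0 P hP; exact: h.
Qed.

Lemma RRspace_subspace D : subspace iota (RR D).
Proof.
split.
- apply/RRspaceP; split; first exact: (sr0 (dr_sr hE)).
  by move=> P hP; rewrite /val_ge eqxx.
- move=> a b /RRspaceP[Ea ha] /RRspaceP[Eb hb]; apply/RRspaceP.
  split; first exact: (srB (dr_sr hE)).
  by move=> P hP; apply: (val_geB hE hP (ex_param hP)) => //; [exact: ha | exact: hb].
- move=> c a /RRspaceP[Ea ha]; apply/RRspaceP.
  split; first by apply: srM; [exact: dr_sr | apply: kE; exists c |].
  by move=> P hP; apply: (val_geZ hE hP (ex_param hP)) => //; exact: ha.
Qed.

Lemma RRspace_eq D D' : (forall P, is_place k E P -> D P = D' P) -> RR D = RR D'.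
Proof.
move=> DD; apply/seteqP; split=> z /RRspaceP[Ez h]; apply/RRspaceP.
  by split=> // P hP; rewrite -DD //; exact: h.
by split=> // P hP; rewrite DD //; exact: h.
Qed.

Definition add_place (D : set F -> int) (P : set F) : set F -> int :=
  fun Q => D Q + (Q == P)%:R.

Lemma RRspace_add_sub D P : RR D `<=` RR (add_place D P).
Proof.
move=> z /RRspaceP[Ez h]; apply/RRspaceP; split=> // Q hQ z0.
by apply: le_trans (h Q hQ z0); rewrite lerN2 lerDl.
Qed.

Lemma RRspace_add_pole D P w n : is_place k E P -> RR (add_place D P) w -> w != 0 ->
  valuation P w = - (D P + 1) -> has_dim k (RR D) [set 0] n ->
  has_dim k (RR (add_place D P)) [set 0] n.+1.
Proof.
move=> hP D'w w0 vw; have /RRspaceP[Ew hw] := D'w.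
apply: (has_dim_step (RRspace_subspace D) (@RRspace_add_sub D P) D'w).
  by move=> /RRspaceP[_ /(_ P hP w0)]; rewrite vw lerN2 gerDl.
move=> z D'z; have /RRspaceP[Ez hz] := D'z.
have vz : val_ge P (- (D P + 1)) z.
  by have := hz P hP; rewrite /add_place eqxx.
have [c hc] := val_ge_lead hE hP (ex_param hP) Ez Ew w0 vw vz.
exists c; have /RRspaceP[Ezw hzw] : RR (add_place D P) (z - iota c * w).
  by case: (RRspace_subspace (add_place D P)) => _ VB VZ; apply: VB => //; exact: VZ.
apply/RRspaceP; split=> // Q hQ; have [->|QP] := eqVneq Q P.
  by move: hc; rewrite opprD subrK.
by have := hzw Q hQ; rewrite /add_place (negPf QP) addr0.
Qed.

(** When the inclusion is strict, any function in the difference has order exactly - (D P + 1) at P,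
    and it serves as the additional basis vector. *)
Lemma RRspace_add_place D P n : is_place k E P -> has_dim k (RR D) [set 0] n ->
  exists2 n', has_dim k (RR (add_place D P)) [set 0] n' & (n' <= n.+1)%N.
Proof.
move=> hP hD; have DD' := @RRspace_add_sub D P.
have [D'D|] := pselect (RR (add_place D P) `<=` RR D).
  by exists n => //; have -> : RR (add_place D P) = RR D by apply/seteqP.
move=> /existsNP[w /not_implyP[D'w NDw]]; exists n.+1 => //.
have /RRspaceP[Ew hw] := D'w.
have w0 : w != 0.
  by apply/eqP => w0; apply: NDw; rewrite w0; case: (RRspace_subspace D).
apply: (RRspace_add_pole hP D'w w0) => //.
apply/eqP; have := hw P hP w0; rewrite /add_place eqxx => vw.
rewrite eq_le vw andbT leNgt; apply/negP => vw'; apply: NDw.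
apply/RRspaceP; split=> // Q hQ _.
have := hw Q hQ w0; rewrite /add_place; have [->|_] := eqVneq Q P; last by rewrite addr0.
by move=> _; move: vw'; rewrite -lezD1 opprD subrK.
Qed.

Lemma RRspace_add_places D (s : seq (set F)) n :
  (forall P, P \in s -> is_place k E P) -> has_dim k (RR D) [set 0] n ->
  exists2 n', has_dim k (RR (fun Q => D Q + (count_mem Q s)%:Z)) [set 0] n'
            & (n' <= n + size s)%N.
Proof.
elim: s n D => [|P s IHs] n D hs hD.
  by exists n; rewrite ?addn0 // (@RRspace_eq _ D) // => Q _; rewrite addr0.
have hP : is_place k E P by apply: hs; rewrite mem_head.
have [n1 hD1 n1n] := RRspace_add_place hP hD.
have [|n2 hD2 n2n] := IHs _ _ _ hD1.
  by move=> Q Qs; apply: hs; rewrite in_cons Qs orbT.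
exists n2; last by rewrite /= addnS (leq_trans n2n) // -addSn leq_add2r.
rewrite (@RRspace_eq _ (fun Q => add_place D P Q + (count_mem Q s)%:Z)) //.
by move=> Q _; rewrite /= /add_place PoszD addrA [P == Q]eq_sym natz.
Qed.

Lemma divisor_degreeE D (T : seq (set F)) : uniq T ->
  (forall P, P \in T -> is_place k E P) -> (forall P, D P != 0 -> P \in T) ->
  divisor_degree k E D = \sum_(P <- T) D P.
Proof.
move=> uT hT DT; rewrite /divisor_degree (fsbigE T) //.
- rewrite big_seq_cond [RHS]big_seq; apply: eq_big => P.
    by rewrite andb_idr // => /hT PT; apply/mem_set.
  by move=> /andP[/hT hP _]; rewrite place_degree1 // mulr1.
- move=> P _ PT; have [->|/DT] := eqVneq (D P) 0; first by rewrite mul0r.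
  by rewrite (negPf PT).
Qed.

(* Multiplication by h identifies L(D) with L(D - (h)), and N Q - (D - (h)) is
   effective: its degree bounds the codimension of L(D - (h)) in L(N Q). *)
Lemma RRspace_dim_lower (Q : set F) (g : nat) (D : set F -> int) (h : F)
    (T : seq (set F)) :
  is_place k E Q ->
  (forall D, (forall P, D P <= 0) -> D Q < 0 -> RR D `<=` [set 0]) ->
  (forall N, exists N' n, [/\ (N <= N')%N, (n + g = N'.+1)%N &
     has_dim k (RR (fun P => if P == Q then N'%:Z else 0)) [set 0] n]) ->
  E h -> h != 0 -> uniq T -> Q \in T -> (forall P, P \in T -> is_place k E P) ->
  (forall P, D P != 0 -> P \in T) ->
  (forall P, is_place k E P -> valuation P h != 0 -> P \in T) ->
  (forall P, is_place k E P -> P != Q -> D P <= valuation P h) ->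
  \sum_(P <- T) valuation P h <= 0 ->
  divisor_degree k E D - (ell k E D)%:Z + 1 <= g%:Z.
Proof.
move=> hQ RRneg RRQ Eh h0 uT QT hT DT vT Dv degh.
pose v P := valuation P h.
(* N is taken large enough for N Q - (D - (h)) to be effective at Q as well; away from Q this is the
   hypothesis on h. *)
have [N [nN [leN nNE hN]]] := RRQ `|D Q - v Q|%N.
pose m P := (if P == Q then N%:Z else 0) - D P + v P.
have m_ge0 P : is_place k E P -> 0 <= m P.
  move=> hP; rewrite /m; have [->|PQ] := eqVneq P Q; last first.
    by rewrite add0r addrC subr_ge0; exact: Dv.
  by move: leN; clear; lia.
pose s := flatten [seq nseq `|m P|%N P | P <- T].
have cs P : is_place k E P -> (count_mem P s)%:Z = m P.
  move=> hP; rewrite /s count_flatten -map_comp sumnE big_map.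
  have [PT|PT] := boolP (P \in T).
    rewrite (bigD1_seq P) //= count_nseq /= eqxx mul1n big1 ?addn0 ?gez0_abs ?m_ge0 //.
    by move=> P' /negPf P'P; rewrite count_nseq /= P'P mul0n.
  rewrite big_seq big1.
    rewrite /m; have [PQ|PQ] := eqVneq P Q; first by rewrite PQ QT in PT.
    have -> : D P = 0 by apply/eqP; apply: contraNT PT; exact: DT.
    have -> : v P = 0 by apply/eqP; apply: contraNT PT; exact: vT.
    by [].
  move=> P' P'T; rewrite /= count_nseq /=; have [P'P|_] := eqVneq P' P => //.
  by rewrite -P'P P'T in PT.
have hs P : P \in s -> is_place k E P.
  by move=> /flattenP[_ /mapP[P' P'T ->]] /nseqP[-> _]; exact: hT.
have sz : (size s)%:Z = N%:Z - divisor_degree k E D + \sum_(P <- T) v P.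
  rewrite (divisor_degreeE uT) // /s size_flatten /shape -map_comp sumnE big_map.
  rewrite (big_morph Posz PoszD (erefl _)) /= -sumrN.
  transitivity (\sum_(P <- T) m P).
    rewrite !big_seq; apply: eq_bigr => P /hT hP.
    by rewrite size_nseq gez0_abs ?m_ge0.
  rewrite /m !big_split /= (bigD1_seq Q) //= eqxx big1 ?addr0 //.
  by move=> P /negPf ->.
pose D1 P := (if P == Q then N%:Z else 0) - (count_mem P s)%:Z.
have D1E P : is_place k E P -> D1 P = D P - v P.
  by move=> hP; rewrite /D1 cs // /m; ring.
(* [ell] takes a default value on spaces of infinite dimension, so L(D1) must first be shown finite
   dimensional: D1 is D0 + (N + 1) Q on places, and L(D0) = 0. *)
pose D0 P := (if P == Q then -1 else 0) - (count_mem P s)%:Z.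
have hD0 : has_dim k (RR D0) [set 0] 0.
  have -> : RR D0 = [set 0]; last exact: has_dim0.
  apply/seteqP; split; last by move=> _ ->; case: (RRspace_subspace D0).
  by apply: RRneg => [P|]; rewrite /D0 ?eqxx; [case: (P == Q)|]; lia.
have [n1 hn1 _] : exists2 n1, has_dim k (RR D1) [set 0] n1 & True.
  have [|n1 hn1 _] := @RRspace_add_places _ (nseq N.+1 Q) _ _ hD0.
    by move=> P /nseqP[->].
  exists n1 => //; rewrite (RRspace_eq (D' := fun P => D0 P + (count_mem P (nseq N.+1 Q))%:Z)) //.
  move=> P _; rewrite /D1 /D0 count_nseq /= [Q == P]eq_sym.
  by case: (P == Q); lia.
have [n2 hn2 n2le] := RRspace_add_places hs hn1.
have n2n : n2 = nN.
  apply: has_dim_inj (subspace0 iota) hn2 _.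
  by rewrite (RRspace_eq (D' := fun P => if P == Q then N%:Z else 0)) // => P _; rewrite /D1 subrK.
have -> : ell k E D = n1.
  apply: dimE; first exact: subspace0.
  apply: (has_dim_scale h0 _ hn1) => z; split=> [/RRspaceP[Ez hz]|/RRspaceP[Ehz hz]].
    apply/RRspaceP; split; first by apply: srM => //; exact: dr_sr.
    move=> P hP; rewrite D1E // /val_ge mulf_eq0 negb_or => /andP[_ z0].
    by rewrite (valuationM hE hP (ex_param hP)) // opprB lerD2l; exact: hz.
  have Ez : E z by rewrite -(mulKf h0 z); apply: srM => //; [exact: dr_sr | exact: dr_V].
  apply/RRspaceP; split=> // P hP z0.
  have := hz P hP; rewrite D1E // /val_ge mulf_neq0 // => /(_ isT).
  by rewrite (valuationM hE hP (ex_param hP)) // opprB lerD2l.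
(* The bound is N + 1 - g <= ell D + size s, where size s = N - deg D + (sum of the orders of h),
   and that last sum is at most 0. *)
rewrite n2n in n2le; move: sz degh; rewrite -/v; set d := divisor_degree _ _ _.
set e : int := \sum_(P <- T) v P; move: n2le; clearbody e d.
by set a := size s; clearbody a; clear -nNE; lia.
Qed.

(** The third hypothesis provides multiples of Q at which the maximum is attained. The fourth,
    through [RRspace_dim_lower], bounds all other divisors: h plays the part of a common denominator
    that moves the poles allowed by D to Q. *)
Lemma genusE (Q : set F) (g : nat) :
  is_place k E Q ->
  (forall D, (forall P, D P <= 0) -> D Q < 0 -> RR D `<=` [set 0]) ->
  (forall N, exists N' n, [/\ (N <= N')%N, (n + g = N'.+1)%N &
     has_dim k (RR (fun P => if P == Q then N'%:Z else 0)) [set 0] n]) ->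
  (forall D, is_divisor k E D -> exists h T, [/\ E h /\ h != 0,
     uniq T /\ Q \in T,
     (forall P, P \in T -> is_place k E P),
     (forall P, D P != 0 \/ is_place k E P /\ valuation P h != 0 -> P \in T) &
     (forall P, is_place k E P -> P != Q -> D P <= valuation P h) /\
     \sum_(P <- T) valuation P h <= 0]) ->
  genus k E = g.
Proof.
move=> hQ RRneg RRQ hD.
have upper D : is_divisor k E D -> divisor_degree k E D - (ell k E D)%:Z + 1 <= g%:Z.
  move=> /hD[h [T [[Eh h0] [uT QT] hT DT [Dv degh]]]].
  apply: (RRspace_dim_lower hQ RRneg RRQ Eh h0 uT QT hT) => // P.
    by move=> ?; apply: DT; left.
  by move=> ? ?; apply: DT; right.
have attained : exists2 D, is_divisor k E D & g%:Z = divisor_degree k E D - (ell k E D)%:Z + 1.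
  have [N [n [_ ng hN]]] := RRQ 0%N.
  exists (fun P => if P == Q then N%:Z else 0).
    split; last by move=> P /=; case: (eqVneq P Q) => [->|].
    apply: (@sub_finite_set _ _ [set Q]); last exact: finite_set1.
    by move=> P /=; case: (eqVneq P Q) => [->|].
  rewrite (divisor_degreeE (T := [:: Q])) //.
  - rewrite big_seq1 eqxx /ell (dimE (subspace0 iota) hN); lia.
  - by move=> P; rewrite inE => /eqP ->.
  - by move=> P; rewrite inE; case: (P == Q).
apply: xget_unique; first by split.
move=> g' [[D' hD' g'E] g'max]; have [D DD gE] := attained.
apply/eqP; rewrite -eqz_nat eq_le {1}g'E upper //=.
by rewrite gE g'max.
Qed.

End RiemannRoch.

(** * Apery sets *)

Section AperyCombinatorics.
Variables (m r : nat) (lambda : 'I_r -> nat).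

Lemma floor_mod j i : (m * (j * lambda i %/ m) + j * lambda i %% m = j * lambda i)%N.
Proof. by rewrite mulnC -divn_eq. Qed.

(* The pole order at infinity of y^j / floor_poly j. *)
Definition apery (j : nat) : nat := \sum_(i < r) (j * lambda i %% m).

Lemma apery_floor j :
  (apery j + m * \sum_(i < r) (j * lambda i %/ m) = j * \sum_(i < r) lambda i)%N.
Proof.
rewrite /apery !big_distrr -big_split /=; apply: eq_bigr => i _.
by rewrite addnC floor_mod.
Qed.

(** A boolean form of membership, so that the elements below a bound can be counted by a sum. *)
Definition apery_semigroup (s : nat) : bool :=
  [exists j : 'I_m, (apery j <= s)%N && (s == apery j %[mod m])].

Lemma apery_semigroupP s :
  reflect (exists (j : 'I_m) n, s = (apery j + m * n)%N) (apery_semigroup s).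
Proof.
apply: (iffP existsP) => [[j /andP[js sj]]|[j [n ->]]]; exists j.
  exists ((s - apery j) %/ m)%N; rewrite mulnC divnK ?subnKC //.
  by rewrite -eqn_mod_dvd.
by rewrite leq_addr addnC [(m * n)%N]mulnC modnMDl eqxx.
Qed.

Hypothesis m_gt0 : (0 < m)%N.
Hypothesis r_gt0 : (0 < r)%N.
Hypothesis lambda_coprime : forall i, coprime m (lambda i).
Hypothesis lambda0_coprime : coprime m (\sum_(i < r) lambda i)%N.

Local Notation lambda0 := (\sum_(i < r) lambda i)%N.
Local Notation inS := apery_semigroup.

Definition mul_mod (c : nat) (j : 'I_m) : 'I_m := Ordinal (ltn_pmod (j * c) m_gt0).

Lemma mul_mod_inj c : coprime m c -> injective (mul_mod c).
Proof.
move=> mc j j' /(congr1 val) /= /eqP jj; apply: val_inj => /=.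
wlog le : j j' jj / (j <= j')%N.
  move=> H; have [le|le] := leqP j j'; first exact: H.
  by apply/esym/H; rewrite 1?eq_sym // ltnW.
move: jj; rewrite eq_sym eqn_mod_dvd ?leq_mul2r ?le ?orbT // -mulnBl.
rewrite Gauss_dvdl // -eqn_mod_dvd // !modn_small // => /eqP.
by [].
Qed.

Lemma sum_mul_mod c : coprime m c -> (\sum_(j < m) (j * c %% m) = \sum_(j < m) j)%N.
Proof. by move=> mc; rewrite [RHS](reindex_inj (mul_mod_inj mc)). Qed.

Lemma apery_mod j : apery j = j * lambda0 %[mod m].
Proof. by rewrite -apery_floor addnC mulnC modnMDl. Qed.

Lemma apery_mod_inj (j j' : 'I_m) : apery j = apery j' %[mod m] -> j = j'.
Proof.
rewrite !apery_mod => jj; apply: (mul_mod_inj lambda0_coprime).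
by apply: val_inj.
Qed.

(** The Apery elements are distinct modulo m, so within the class of [apery j] only j can witness
    membership; this decides block by block of length m. *)
Lemma apery_semigroup_block M (j : 'I_m) :
  inS (m * M + apery j %% m) = (apery j %/ m <= M)%N.
Proof.
have mM : (m * M + apery j %% m = apery j %[mod m])%N.
  by rewrite mulnC modnMDl modn_mod.
have le_aM (i : 'I_m) : apery i = apery j %[mod m] ->
    (apery i <= m * M + apery j %% m)%N = (apery j %/ m <= M)%N.
  move=> /apery_mod_inj ->; rewrite {1}(divn_eq (apery j) m) leq_add2r mulnC.
  by rewrite leq_pmul2l.
apply/existsP/idP => [[i /andP[ai /eqP aj]]|qM].
  by rewrite -(le_aM i) // -aj mM.
by exists j; rewrite le_aM // qM mM eqxx.
Qed.

Lemma count_apery_semigroup M :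
  (\sum_(0 <= s < m * M) inS s = \sum_(j < m) (M - apery j %/ m))%N.
Proof.
elim: M => [|M IHM].
  by rewrite muln0 big_geq // big1 // => j _; rewrite sub0n.
rewrite mulnS addnC (@big_cat_nat _ _ _ (m * M)) ?leq_addr //= IHM.
have -> : (\sum_(m * M <= s < m * M + m) inS s = \sum_(t < m) inS (m * M + t))%N.
  rewrite -{1}[(m * M)%N]add0n big_addn addKn big_mkord.
  by apply: eq_bigr => t _; rewrite addnC.
(* The residues of one block are indexed by j through j lambda_0 mod m, which is the class of
   [apery j]. *)
rewrite [X in (_ + X)%N](reindex_inj (mul_mod_inj lambda0_coprime)) -big_split /=.
apply: eq_bigr => j _; rewrite -apery_mod apery_semigroup_block.
by case: leqP => h; lia.
Qed.

(** Selmer's formula for the number of gaps: the class of [apery j] omits exactly [apery j %/ m]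
    natural numbers. *)
Definition apery_genus : nat := \sum_(j < m) (apery j %/ m).

Lemma count_apery_genus M : (apery_genus <= M)%N ->
  (\sum_(0 <= s < m * M) inS s + apery_genus = m * M)%N.
Proof.
move=> gM; rewrite count_apery_semigroup -big_split /=.
transitivity (\sum_(j < m) M)%N; last by rewrite sum_nat_const card_ord.
(* M is at least every single quotient, so the truncated subtractions are exact. *)
apply: eq_bigr => j _; rewrite subnK // (leq_trans _ gM) //.
by rewrite /apery_genus (bigD1 j) //= leq_addr.
Qed.

(** The sum of all [apery j] is computed in two ways. By Euclidean division it is m times the number
    of gaps plus the sum of the residues, which run over 0, ..., m - 1; exchanging the sums, each i
    contributes a permutation of the same residues. *)
Lemma apery_genusE : (2 * apery_genus = (m - 1) * (r - 1))%N.
Proof.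
have tri : (2 * \sum_(j < m) j = m * (m - 1))%N.
  rewrite -(big_mkord xpredT id) bin2_sum bin2 mul2n halfK oddM.
  by case: m m_gt0 => // n _; rewrite /= andNb subn0 subn1.
have mg : (m * apery_genus + \sum_(j < m) j = r * \sum_(j < m) j)%N.
  rewrite -{1}(sum_mul_mod lambda0_coprime) /apery_genus big_distrr -big_split /=.
  transitivity (\sum_(j < m) apery j)%N.
    by apply: eq_bigr => j _; rewrite -apery_mod mulnC -divn_eq.
  rewrite exchange_big /=; under eq_bigr => i _ do rewrite sum_mul_mod //.
  by rewrite sum_nat_const card_ord.
move: mg tri; move: (\sum_(j < m) j)%N apery_genus => t g mg tri.
by apply/eqP; rewrite -(eqn_pmul2l m_gt0); apply/eqP; nia.
Qed.

End AperyCombinatorics.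

(** * Frobenius number and multiplicity of the semigroup *)

Section CastleCombinatorics.
Variables (m r : nat) (lambda : 'I_r -> nat).
Hypothesis m_gt1 : (1 < m)%N.
Hypothesis r_gt0 : (0 < r)%N.
Hypothesis lambda_coprime : forall i, coprime m (lambda i).
Hypothesis lambda0_coprime : coprime m (\sum_(i < r) lambda i)%N.

Local Notation apery := (apery m lambda).
Local Notation inS := (apery_semigroup m lambda).
Local Notation frob := ((m - 1) * (r - 1) - 1)%N.

Let m_gt0 : (0 < m)%N. Proof. exact: ltnW. Qed.

Lemma mul_mod_surj c (t : nat) : coprime m c -> (t < m)%N ->
  exists j : 'I_m, (j * c %% m)%N = t.
Proof.
move=> mc tm; have inj := @mul_mod_inj m m_gt0 c mc.
by exists (invF inj (Ordinal tm)); have /(congr1 val) /= := f_invF inj (Ordinal tm).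
Qed.

Lemma exists_apery_mod s : exists j : 'I_m, apery j = s %[mod m].
Proof.
have [j js] := mul_mod_surj lambda0_coprime (ltn_pmod s m_gt0).
by exists j; rewrite apery_mod js.
Qed.

Lemma apery_le j : (apery j <= r * (m - 1))%N.
Proof.
rewrite -[X in (_ <= X * _)%N]card_ord -sum_nat_const; apply: leq_sum => i _.
by rewrite subn1 -ltnS prednK // ltn_pmod.
Qed.

Lemma ltn_mod_add a b : (a < b)%N -> a = b %[mod m] -> (a + m <= b)%N.
Proof.
move=> ab /eqP; rewrite eq_sym eqn_mod_dvd; last exact: ltnW.
by move=> /dvdn_leq; rewrite subn_gt0 => /(_ ab); lia.
Qed.

Lemma frobenius_all_equal : ((m - 1) * (r - 1) > 0)%N -> ~~ inS frob ->
  forall i i', lambda i = lambda i' %[mod m].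
Proof.
move=> mr Nf; have [j jf] := exists_apery_mod frob.
have lt_f : (frob < apery j)%N.
  rewrite ltnNge; apply: contra Nf => le; apply/existsP; exists j.
  by rewrite le; apply/eqP.
(* A gap in the class of [apery j] lies at least m below it, and [frob] + m = r (m - 1) is the upper
   bound of [apery_le]; hence every summand of [apery j] is maximal. *)
have ge_max : (r * (m - 1) <= apery j)%N.
  by apply: leq_trans (ltn_mod_add lt_f (esym jf)); nia.
have jl i : (j * lambda i %% m)%N = (m - 1)%N.
  have le_i i' : (j * lambda i' %% m <= m - 1)%N by rewrite subn1 -ltnS prednK // ltn_pmod.
  apply/eqP; rewrite eqn_leq le_i /=; move: ge_max.
  rewrite /apery (bigD1 i) //=.
  have : (\sum_(i' < r | i' != i) (j * lambda i' %% m) <= (r - 1) * (m - 1))%N.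
    apply: (@leq_trans (\sum_(i' < r | i' != i) (m - 1))%N); first by apply: leq_sum.
    by rewrite (eq_bigl [in predC1 i]) // sum_nat_const cardC1 card_ord !subn1.
  have -> : (r * (m - 1) = m - 1 + (r - 1) * (m - 1))%N.
    by rewrite -mulSn [(r - 1)%N]subn1 prednK.
  by move: ((r - 1) * (m - 1))%N (\sum_(_ < r | _) _)%N => a b; lia.
(* Since m - 1 is prime to m, so is j, which can then be cancelled from j lambda_i = j lambda_i'
   modulo m. *)
have mj : coprime m j.
  have i0 : 'I_r := Ordinal r_gt0.
  have : coprime m (j * lambda i0).
    by rewrite -coprime_modr jl subn1 coprimenP.
  by rewrite coprimeMr => /andP[].
have lm i : (lambda i %% m < m)%N by rewrite ltn_pmod.
move=> i i'; apply: (congr1 val (_ : Ordinal (lm i) = Ordinal (lm i'))).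
apply: (mul_mod_inj (m_gt0 := m_gt0) mj); apply: val_inj => /=.
by rewrite !modnMml ![(lambda _ * j)%N]mulnC !jl.
Qed.

Section Equal.
Variable l : nat.
Hypotheses (lE : forall i, lambda i = l).

Let ml : coprime m l. Proof. by rewrite -(lE (Ordinal r_gt0)). Qed.

Lemma apery_equal j : apery j = (r * (j * l %% m))%N.
Proof.
rewrite /apery; under eq_bigr do rewrite lE.
by rewrite sum_nat_const card_ord.
Qed.

Lemma frobenius_equal (H : set nat) : (0 < (m - 1) * (r - 1))%N ->
  (forall s, H s <-> inS s) -> is_frobenius H frob.
Proof.
move=> mr HS; have lt_m1 : (m - 1 < m)%N by rewrite subn1 prednK.
(* The index with j l = -1 modulo m gives the largest Apery element r (m - 1); the largest gap lies
   m below it. *)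
have [j jl] := mul_mod_surj ml lt_m1.
have aj : apery j = (frob + m)%N by rewrite apery_equal jl; nia.
split.
  move=> /HS/existsP[i /andP[ai /eqP fi]].
  have ij : i = j.
    by apply: (apery_mod_inj m_gt0 lambda0_coprime); rewrite -fi aj modnDr.
  by move: ai; rewrite ij aj; lia.
move=> s Ns; have [i ai] := exists_apery_mod s.
have lt_s : (s < apery i)%N.
  rewrite ltnNge; apply/negP => le; apply/Ns/HS/existsP; exists i.
  by rewrite le; apply/eqP.
have := ltn_mod_add lt_s (esym ai); have := apery_le i; nia.
Qed.

Hypothesis r_lt_m : (r < m)%N.

(** Elements have the form r t + m n, and r itself is [apery j] for j l = 1 modulo m. The bound r <
    m settles the case t = 0. *)
Lemma multiplicity_equal (H : set nat) : (forall s, H s <-> inS s) -> multiplicity H = r.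
Proof.
move=> HS; have Hr : H r.
  have [j jl] := mul_mod_surj ml m_gt1.
  by apply/HS/existsP; exists j; rewrite apery_equal jl muln1 leqnn eqxx.
have rmin s : H s -> (0 < s)%N -> (r <= s)%N.
  move=> /HS/apery_semigroupP[j [n ->]]; rewrite apery_equal.
  case: (j * l %% m)%N => [|t] s0; last by rewrite mulnS -addnA leq_addr.
  by case: n s0 => [|n] s0; [lia | rewrite mulnS; move: (m * n)%N; lia].
apply: xget_unique; first by split.
move=> s [Hs s0 smin]; apply/eqP; rewrite eqn_leq rmin // andbT.
exact: smin.
Qed.

End Equal.
End CastleCombinatorics.

(** * The places, semigroup and genus of a Kummer extension *)

Section KummerExtension.
Variables (m r : nat) (K : closedFieldType) (F : fieldType).
Variables (iota : {rmorphism K -> F}) (x y : F).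
Variables (alpha : 'I_r -> K) (lambda : 'I_r -> nat).

Local Notation k := (range iota).
Local Notation E := (function_field iota x y setT).
Local Notation place := (is_place k E).
Local Notation RR := (RRspace k E).
Local Notation residue_unit := (residue_unit iota).
Local Notation apery := (apery m lambda).
Local Notation apery_semigroup := (apery_semigroup m lambda).

(** * Polynomials in x and y, and fractions with denominator in K[x] *)

Fact commr_x : commr_rmorph iota x. Proof. by move=> c; exact: mulrC. Qed.
Definition evx : {rmorphism {poly K} -> F} := horner_morph commr_x.

Fact commr_y : commr_rmorph evx y. Proof. by move=> c; exact: mulrC. Qed.
Definition evxy : {rmorphism {poly {poly K}} -> F} := horner_morph commr_y.

Fact commr_pt (a b : K) : commr_rmorph (horner_eval a) b.
Proof. by move=> c; exact: mulrC. Qed.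
(** Value at a point (a, b) of the plane; on the curve it is the residue of [evxy] at a place
    centered there. *)
Definition evpt a b : {rmorphism {poly {poly K}} -> K} := horner_morph (commr_pt a b).

Lemma evxX : evx 'X = x. Proof. exact: horner_morphX. Qed.
Lemma evxC c : evx c%:P = iota c. Proof. exact: horner_morphC. Qed.
Lemma evxyX : evxy 'X = y. Proof. exact: horner_morphX. Qed.
Lemma evxyC p : evxy p%:P = evx p. Proof. exact: horner_morphC. Qed.
Lemma evptX a b : evpt a b 'X = b. Proof. exact: horner_morphX. Qed.
Lemma evptC a b p : evpt a b p%:P = p.[a]. Proof. exact: horner_morphC. Qed.

Lemma evx_XsubC a : evx ('X - a%:P) = x - iota a.
Proof. by rewrite rmorphB /= evxX evxC. Qed.

Lemma function_field_divring : divring_closed [in E].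
Proof.
split.
- by apply/mem_set => A [[h _ _] _]; exact/set_mem.
- move=> a b /set_mem Ea /set_mem Eb; apply/mem_set => A hA.
  have [[_ h _] _] := hA; apply/set_mem/h; apply/mem_set; [exact: Ea | exact: Eb].
- move=> a b /set_mem Ea /set_mem Eb; apply/mem_set => A hA.
  have [[_ _ h] _] := hA; apply/set_mem/h; apply/mem_set; [exact: Ea | exact: Eb].
Qed.

Let hE := function_field_divring.
Let srE := dr_sr hE.

Lemma function_field_const c : E (iota c).
Proof. by move=> A [_]; apply; left; exists c. Qed.

Lemma function_field_x : E x.
Proof. by move=> A [_]; apply; right; left. Qed.

Lemma function_field_y : E y.
Proof. by move=> A [_]; apply; right; right. Qed.

Let Ec := function_field_const.
Let Ex := function_field_x.
Let Ey := function_field_y.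
Let kE : k `<=` E. Proof. by move=> _ [c _ <-]. Qed.

Lemma function_field_evx p : E (evx p).
Proof.
apply: (sr_horner srE); last exact: function_field_x.
by move=> i; rewrite coef_map; exact: function_field_const.
Qed.

Lemma function_field_evxy P : E (evxy P).
Proof.
apply: (sr_horner srE); last exact: function_field_y.
by move=> i; rewrite coef_map; exact: function_field_evx.
Qed.

Hypothesis m_gt0 : (0 < m)%N.
Hypothesis m_neq0 : m%:R != 0 :> K.
Hypothesis alpha_inj : injective alpha.
Hypothesis lambda_gt0 : forall i, (0 < lambda i)%N.
Hypothesis lambda_coprime : forall i, coprime m (lambda i).
Hypothesis lambda0_coprime : coprime m (\sum_(i < r) lambda i)%N.
Hypothesis x_trans : ~ algebraicOver iota x.
Hypothesis xy_eq : y ^+ m = \prod_(i < r) (x - iota (alpha i)) ^+ lambda i.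

Lemma evx_eq0 p : (evx p == 0) = (p == 0).
Proof.
apply/idP/eqP => [px|->]; last by rewrite rmorph0.
apply: contrapT => p0; apply: x_trans; exists p => //; exact/eqP.
Qed.

Definition branch_poly : {poly K} := \prod_(i < r) ('X - (alpha i)%:P) ^+ lambda i.

Local Notation f := branch_poly.

Lemma XsubC_prod_neq0 (n : 'I_r -> nat) :
  \prod_(i < r) ('X - (alpha i)%:P) ^+ n i != 0.
Proof. by apply/prodf_neq0 => i _; rewrite expf_neq0 // polyXsubC_eq0. Qed.

Lemma size_XsubC_prod (n : 'I_r -> nat) :
  size (\prod_(i < r) ('X - (alpha i)%:P) ^+ n i) = (\sum_(i < r) n i).+1.
Proof.
rewrite size_prod; last by move=> i _; rewrite expf_neq0 // polyXsubC_eq0.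
under eq_bigr do rewrite size_exp_XsubC -addn1.
by rewrite big_split /= sum1_card card_ord -addSn addnK.
Qed.

Lemma mup_alpha i (n : 'I_r -> nat) :
  mup (alpha i) (\prod_(i < r) ('X - (alpha i)%:P) ^+ n i) = n i.
Proof.
rewrite (bigD1 i) //= mupMl ?mup_XsubCX ?eqxx //.
rewrite /root horner_prod; apply/prodf_neq0 => j ji.
rewrite !hornerE expf_neq0 // subr_eq0.
by apply: contraNneq ji => /alpha_inj ->.
Qed.

Lemma f_neq0 : f != 0. Proof. exact: XsubC_prod_neq0. Qed.

Lemma size_f : size f = (\sum_(i < r) lambda i).+1. Proof. exact: size_XsubC_prod. Qed.

Lemma mup_f i : mup (alpha i) f = lambda i. Proof. exact: mup_alpha. Qed.

Lemma y_pow : y ^+ m = evx f.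
Proof.
by rewrite xy_eq rmorph_prod; apply: eq_bigr => i _; rewrite rmorphXn /= evx_XsubC.
Qed.

Lemma integral_evxy P : integralOver evx (evxy P).
Proof.
apply: integral_horner.
  by apply/integral_poly => i; rewrite coef_map; exact: integral_id.
exists ('X^m - f%:P); first exact: monicXnsubC.
by rewrite /root rmorphB /= map_polyXn map_polyC /= !hornerE y_pow subrr.
Qed.

(** Stripping powers of X from an integral equation leaves q with q(0) nonzero that still vanishes
    at the given value. Writing q = q(0) + X q', the value of q' is the required cofactor and c = -
    q(0). *)
Lemma evxy_norm P : evxy P != 0 ->
  exists P' c, c != 0 /\ evxy P * evxy P' = evx c.
Proof.
move=> P0; have [G Gmon Gz] := integral_evxy P.
have [n [q]] := multiplicity_XsubC G 0; rewrite monic_neq0 //= => q0 GE.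
have qz : root (map_poly evx q) (evxy P).
  move: Gz; rewrite GE rmorphM rmorphXn /= map_polyXsubC rmorph0 subr0 rootM.
  by rewrite /root hornerXn expf_eq0 (negPf P0) andbF orbF.
have /factor_theorem[q' q'E] : root (q - q.[0]%:P) 0 by rewrite /root !hornerE subrr.
exists (map_poly polyC q').[P], (- q.[0]); split; first by rewrite oppr_eq0.
rewrite -horner_map /= -map_poly_comp (eq_map_poly (g := evx)); last first.
  by move=> p /=; rewrite evxyC.
have /eqP : (map_poly evx q).[evxy P] == 0 by [].
have -> : q = q.[0]%:P + q' * 'X.
  by rewrite -['X]subr0 -[0]/(0%:P) -q'E addrC subrK.
rewrite rmorphD rmorphM /= map_polyC map_polyX !hornerE /= => /eqP.
rewrite addrC addr_eq0 mulrC => /eqP ->.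
by rewrite rmorphN.
Qed.

(** The fractions with denominator in K[x] already form a field: [evxy_norm] turns division by a
    polynomial in x and y into division by a polynomial in x. *)
Lemma function_fieldP z :
  E z <-> exists P d, d != 0 /\ z = evxy P / evx d.
Proof.
split=> [Ez|[P [d [_ ->]]]]; last first.
  by apply: (dr_div hE); [exact: function_field_evxy | exact: function_field_evx].
apply: (Ez [set z | exists P d, d != 0 /\ z = evxy P / evx d]); split; last first.
  move=> _ [[c _ <-]|[->|->]].
  - exists (c%:P%:P), 1; rewrite oner_neq0; split=> //.
    by rewrite evxyC evxC rmorph1 divr1.
  - by exists ('X%:P), 1; rewrite oner_neq0 evxyC evxX rmorph1 divr1.
  - by exists 'X, 1; rewrite oner_neq0 evxyX rmorph1 divr1.
split.
- by apply/mem_set; exists 1, 1; rewrite oner_neq0 !rmorph1 divr1.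
- move=> _ _ /set_mem[P [d [d0 ->]]] /set_mem[P' [d' [d'0 ->]]]; apply/mem_set.
  exists (P * d'%:P - P' * d%:P), (d * d'); split; first exact: mulf_neq0.
  rewrite rmorphB !rmorphM /= !evxyC; have : evx d != 0 by rewrite evx_eq0.
  have : evx d' != 0 by rewrite evx_eq0.
  by move=> ? ?; field; apply/andP.
- move=> _ _ /set_mem[P [d [d0 ->]]] /set_mem[P' [d' [d'0 ->]]]; apply/mem_set.
  have [P'0|P'0] := eqVneq (evxy P') 0.
    by exists 0, 1; rewrite oner_neq0 P'0 rmorph0 !mul0r invr0 mulr0.
  have [Q [c [c0 Qc]]] := evxy_norm P'0.
  exists (P * Q * d'%:P), (d * c); split; first exact: mulf_neq0.
  have c0' : evx c != 0 by rewrite evx_eq0.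
  have Q0 : evxy Q != 0 by apply: contraNneq c0' => Q0; rewrite -Qc Q0 mulr0.
  rewrite !rmorphM /= evxyC -Qc; have : evx d != 0 by rewrite evx_eq0.
  have : evx d' != 0 by rewrite evx_eq0.
  by move=> d'0' d0'; field; rewrite Q0 P'0 d0' d'0'.
Qed.

(** The remainder modulo Y^m - f(X), a polynomial that vanishes at (x, y) and at every point of the
    affine curve. *)
Lemma evxy_reduce (P : {poly {poly K}}) : exists R : {poly {poly K}},
  [/\ (size R <= m)%N, evxy R = evxy P &
      forall a b, b ^+ m = f.[a] -> evpt a b R = evpt a b P].
Proof.
pose D : {poly {poly K}} := 'X^m - f%:P.
have Dmon : D \is monic by exact: monicXnsubC.
exists (Pdiv.Ring.rmodp P D); split.
- have := Pdiv.Ring.ltn_rmodpN0 P (monic_neq0 Dmon).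
  by rewrite size_XnsubC.
- rewrite [in RHS](Pdiv.RingMonic.rdivp_eq Dmon P) rmorphD rmorphM /= [evxy D]rmorphB /=.
  by rewrite rmorphXn /= evxyX evxyC (y_pow) subrr mulr0 add0r.
- move=> a b ab.
  rewrite [in RHS](Pdiv.RingMonic.rdivp_eq Dmon P) rmorphD rmorphM /= [evpt _ _ D]rmorphB /=.
  by rewrite rmorphXn /= evptX evptC ab subrr mulr0 add0r.
Qed.

Lemma evxy_sum (P : {poly {poly K}}) : (size P <= m)%N ->
  evxy P = \sum_(j < m) evx P`_j * y ^+ j.
Proof.
move=> sP; rewrite -[evxy P]/(map_poly evx P).[y] (@horner_coef_wide _ m).
  by apply: eq_bigr => j _; rewrite coef_map.
by rewrite (leq_trans (size_poly _ _)).
Qed.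

(** * Expansions at the ramified places *)

Lemma sum_distinct_valuations O t (I : finType) (A : pred I) (n : I -> int)
    (u : I -> F) i0 : is_place k E O -> maxideal O t -> t != 0 ->
  (forall i, A i -> residue_unit O (u i)) -> A i0 ->
  (forall i, A i -> i != i0 -> n i0 < n i) ->
  exists2 w, residue_unit O w
           & \sum_(i | A i) t ^ n i * u i = t ^ n i0 * w.
Proof.
move=> hO Mt t0 hu A0 hn.
exists (u i0 + \sum_(i | A i && (i != i0)) t ^ (n i - n i0) * u i).
  apply: (residue_unitD hE hO); first exact: hu.
  apply: (maxideal_sum hE hO) => i /andP[Ai ii0]; rewrite mulrC.
  apply: (maxidealM hO); first by apply: (residue_unit_place hO); exact: hu.
  by apply: (maxideal_Xz hO) => //; rewrite subr_gt0 hn.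
rewrite (bigD1 i0) //= mulrDr mulr_sumr; congr (_ + _); apply: eq_bigr => i _.
by rewrite mulrA -expfzDr // addrC subrK.
Qed.

(* Places lying over one place of K(x), with local parameter s and valuation ord
   there. *)
Definition ramified (Cen : set (set F)) (s : F) (ord : {poly K} -> int) :=
  forall O, Cen O -> [/\ is_place k E O, maxideal O s, s != 0 &
    forall p, p != 0 -> exists2 u, residue_unit O u & evx p = s ^ ord p * u].

Section Ramified.
Variables (Cen : set (set F)) (s : F) (ord : {poly K} -> int).
Hypothesis hs : ramified Cen s ord.
Hypothesis Es : E s.
Hypothesis f_coprime : coprimez m (ord f).

(** With a m + b ord f = 1 and t = s^a y^b, the relation y^m = s^(ord f) v gives t^m = s v^b and y =
    t^(ord f) v^a. The same t serves all places in [Cen]. *)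
Lemma ramified_param : exists t, forall O, Cen O ->
  [/\ maxideal O t, t != 0,
   (forall p, p != 0 -> exists2 u, residue_unit O u & evx p = t ^ (m%:Z * ord p) * u)
   & exists2 u, residue_unit O u & y = t ^ ord f * u].
Proof.
have [a [b]] := Bezoutz m (ord f); rewrite (eqP f_coprime).
set c := ord f => ab.
exists (s ^ a * y ^ b) => O /hs[hO Ms s0 hp].
set t := s ^ a * y ^ b.
have [v Uv fE] := hp _ f_neq0; rewrite -/c in fE.
have v0 := residue_unit_neq0 hE hO Uv.
have ym : y ^ m%:Z = s ^ c * v by rewrite -fE -(y_pow).
have y0 : y != 0.
  apply/eqP => y0; move: ym; rewrite y0 exp0rz.
  have /negPf -> : m%:Z != 0 by rewrite -lt0n.
  by move/esym/eqP; rewrite mulf_eq0 (negPf v0) orbF (negPf (expfz_neq0 _ s0)).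
have t0 : t != 0 by rewrite mulf_neq0 ?expfz_neq0.
have tm : t ^ m%:Z = s * v ^ b.
  rewrite /t expfzMl !exprz_exp [b * _]mulrC -(exprz_exp y) ym expfzMl exprz_exp mulrA.
  by rewrite -expfzDr // [c * b]mulrC ab expr1z.
have Et : E t.
  apply: (srM (dr_sr hE)); first exact: (dr_Xz hE).
  by apply: (dr_Xz hE); exact: function_field_y.
have Mt : maxideal O t.
  have Mtm : maxideal O (t ^+ m).
    rewrite -[t ^+ m]/(t ^ m%:Z) tm mulrC; apply: (maxidealM hO) => //.
    by apply: (residue_unit_place hO); exact: (residue_unitXz hE hO).
  apply: (maxidealX (n := m) hO) => //.
  by apply: (place_root (n := m) hO) => //; exact: (maxideal_sub Mtm).
split=> //.
- move=> p p0; have [u Uu pE] := hp p p0.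
  exists (v ^ (- (b * ord p)) * u).
    by apply: (residue_unitM hE hO) => //; exact: (residue_unitXz hE hO).
  rewrite pE -(exprz_exp t) tm expfzMl exprz_exp mulrA; congr (_ * _).
  by rewrite -mulrA -expfzDr // subrr mulr1.
- exists (v ^ a); first exact: (residue_unitXz hE hO).
  have tc : t ^ c = s ^ (a * c) * (y * (s ^ (- (a * c)) * v ^ (- a))).
    rewrite /t expfzMl !exprz_exp; congr (_ * _).
    have -> : b * c = 1 + m%:Z * - a by rewrite -ab; ring.
    rewrite expfzDr // expr1z -(exprz_exp y) ym expfzMl exprz_exp.
    by congr (_ * (_ ^ _ * _)); ring.
  rewrite tc; transitivity (s ^ (a * c) * s ^ (- (a * c)) * (v ^ (- a) * v ^ a) * y).
    by rewrite -!expfzDr // subrr addNr !mul1r.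
  by ring.
Qed.

(** The order of the term of index j is ord f times j modulo m, and ord f is prime to m: the nonzero
    terms have distinct orders, and the least one is the order of the sum. *)
Lemma ramified_evxy t (P : {poly {poly K}}) : P != 0 -> (size P <= m)%N ->
  (forall O, Cen O -> [/\ maxideal O t, t != 0,
   (forall p, p != 0 -> exists2 u, residue_unit O u & evx p = t ^ (m%:Z * ord p) * u)
   & exists2 u, residue_unit O u & y = t ^ ord f * u]) ->
  exists j : 'I_m, [/\ P`_j != 0,
    (forall i : 'I_m, P`_i != 0 ->
       m%:Z * ord P`_j + ord f * j%:Z <= m%:Z * ord P`_i + ord f * i%:Z) &
    forall O, Cen O -> exists2 u, residue_unit O u
      & evxy P = t ^ (m%:Z * ord P`_j + ord f * j%:Z) * u].
Proof.
move=> P0 sP ht; pose n (i : 'I_m) := m%:Z * ord P`_i + ord f * i%:Z.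
have n_inj i j : n i = n j -> i = j.
  move=> nij; have mij : (m%:Z %| ord f * (i%:Z - j%:Z))%Z.
    apply/dvdzP; exists (ord P`_j - ord P`_i).
    by move: nij; rewrite /n; lia.
  rewrite Gauss_dvdzr // in mij; apply: val_inj => /=.
  by move: mij; rewrite -eqz_mod_dvd !modz_nat eqz_nat !modn_small // => /eqP.
have Pj : exists j : 'I_m, P`_j != 0.
  have lt_m : ((size P).-1 < m)%N by rewrite prednK // size_poly_gt0.
  by exists (Ordinal lt_m); rewrite /= -/(lead_coef P) lead_coef_eq0.
have [j0 Pj0] := Pj.
case: (@Order.TotalTheory.arg_minP _ _ _ j0 (fun j => P`_j != 0) n Pj0) => j Pj' jmin.
exists j; split=> // O CO; have [Mt t0 hp [w Uw yE]] := ht O CO.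
have [hO _ _ _] := hs CO.
have /choice[u hu] i : exists u, P`_i != 0 ->
    residue_unit O u /\ evx P`_i = t ^ (m%:Z * ord P`_i) * u.
  have [->|Pi] := eqVneq P`_i 0; first by exists 0.
  by have [u Uu uE] := hp _ Pi; exists u.
rewrite evxy_sum //.
have -> : \sum_(i < m) evx P`_i * y ^+ i =
    \sum_(i < m | P`_i != 0) t ^ n i * (u i * w ^+ i).
  rewrite (bigID (fun i : 'I_m => P`_i != 0)) /= [X in _ + X]big1 ?addr0.
    apply: eq_bigr => i Pi; have [_ ->] := hu i Pi.
    rewrite yE exprMn -[(t ^ ord f) ^+ i]/((t ^ ord f) ^ i%:Z) exprz_exp.
    by rewrite mulrACA -expfzDr.
  by move=> i; rewrite negbK => /eqP ->; rewrite rmorph0 mul0r.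
have hu' (i : 'I_m) : P`_i != 0 -> residue_unit O (u i * w ^+ i).
  move=> Pi; apply: (residue_unitM hE hO); first by case: (hu i Pi).
  exact: (residue_unitX hE hO).
have hn (i : 'I_m) : P`_i != 0 -> i != j -> n j < n i.
  move=> Pi ij; rewrite lt_neqAle jmin // andbT.
  by apply: contraNneq ij => /n_inj ->.
have [v Uv ->] := sum_distinct_valuations hO Mt t0 hu' Pj' hn.
by exists v.
Qed.

End Ramified.

(* The exponent n depends on z only, so a local center contains at most one
   place. *)
Definition local_center (Cen : set (set F)) (t : F) :=
  forall z, E z -> z != 0 -> exists n : int, forall O, Cen O ->
    [/\ place O, maxideal O t, t != 0 & exists2 u, residue_unit O u & z = t ^ n * u].

Lemma local_center_param Cen t O : local_center Cen t -> Cen O -> local_param iota E O t.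
Proof.
move=> ht CO; have E1 : E 1 by exact: sr1 (dr_sr hE).
have [n /(_ O CO)[hO Mt t0 _]] := ht 1 E1 (oner_neq0 _).
split=> // z Ez z0; have [n' /(_ O CO)[_ _ _ [u Uu zE]]] := ht z Ez z0.
by exists n', u.
Qed.

Lemma local_center_unique Cen t O O' : local_center Cen t -> Cen O -> Cen O' -> O = O'.
Proof.
move=> ht.
suff sub O1 O2 : Cen O1 -> Cen O2 -> O1 `<=` O2.
  by move=> CO CO'; apply/seteqP; split; exact: sub.
move=> C1 C2 z Oz; have [z0|z0] := eqVneq z 0.
  have [n /(_ O2 C2)[h2 _ _ _]] := ht 1 (sr1 (dr_sr hE)) (oner_neq0 _).
  by rewrite z0; exact: sr0 (place_subring h2).
have Ez : E z.
  have [n /(_ O1 C1)[h1 _ _ _]] := ht 1 (sr1 (dr_sr hE)) (oner_neq0 _).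
  exact: (place_sub h1).
have [n hn] := ht z Ez z0.
have [h1 M1 t0 [u1 U1 zE1]] := hn O1 C1; have [h2 M2 _ [u2 U2 zE2]] := hn O2 C2.
rewrite zE2; apply/(place_Xz_unit hE h2) => //.
by apply/(place_Xz_unit hE h1 n M1 t0 U1); rewrite -zE1.
Qed.

Lemma ramified_local_center Cen s ord : ramified Cen s ord -> E s ->
  coprimez m (ord f) -> exists t, local_center Cen t /\ forall O, Cen O ->
  [/\ maxideal O t, t != 0,
   (forall p, p != 0 -> exists2 u, residue_unit O u & evx p = t ^ (m%:Z * ord p) * u)
   & exists2 u, residue_unit O u & y = t ^ ord f * u].
Proof.
move=> hs Es cop; have [t ht] := ramified_param hs Es cop.
exists t; split=> // z /(function_fieldP)[P [d [d0 zE]]] z0.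
have [R [sR RP _]] := evxy_reduce P.
have R0 : R != 0.
  by apply: contraNneq z0 => R0; rewrite zE -RP R0 rmorph0 mul0r.
have [j [_ _ hj]] := ramified_evxy hs cop R0 sR ht.
exists (m%:Z * ord R`_j + ord f * j%:Z - m%:Z * ord d) => O CO.
have [hO _ _ _] := hs O CO; have [Mt t0 hp _] := ht O CO.
split=> //; have [u Uu uE] := hj O CO; have [v Uv vE] := hp d d0.
exists (u / v); first by apply: (residue_unitM hE hO) => //; exact: (residue_unitV hE hO).
rewrite zE -RP uE vE [in RHS]expfzDr // -[in RHS]invr_expz.
have v0 := residue_unit_neq0 hE hO Uv; have e0 n := expfz_neq0 n t0.
by field; rewrite v0 e0.
Qed.

Lemma ramified_valuation Cen s ord O : ramified Cen s ord -> E s ->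
  coprimez m (ord f) -> Cen O ->
  (forall p, p != 0 -> valuation O (evx p) = m%:Z * ord p) /\
  (forall P : {poly {poly K}}, P != 0 -> (size P <= m)%N -> exists j : 'I_m,
    [/\ P`_j != 0, valuation O (evxy P) = m%:Z * ord P`_j + ord f * j%:Z &
     (forall i : 'I_m, P`_i != 0 ->
        valuation O (evxy P) <= m%:Z * ord P`_i + ord f * i%:Z)] /\ evxy P != 0).
Proof.
move=> hs Es cop CO; have [t [tC ht]] := ramified_local_center hs Es cop.
have lt := local_center_param tC CO; have [hO _ _ _] := hs O CO.
split=> [p p0|P P0 sP].
  have [_ _ /(_ p p0)[u Uu ->] _] := ht O CO.
  exact: (valuation_param hE hO lt).
have [j [Pj jmin /(_ O CO)[u Uu PE]]] := ramified_evxy hs cop P0 sP ht.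
have vP : valuation O (evxy P) = m%:Z * ord P`_j + ord f * j%:Z.
  by rewrite PE; exact: (valuation_param hE hO lt).
exists j; split; last first.
  have [_ t0 _ _] := ht O CO.
  by rewrite PE mulf_neq0 ?expfz_neq0 // (residue_unit_neq0 hE hO Uu).
by split=> // i; rewrite vP; exact: jmin.
Qed.

Lemma root_f a : root f a -> exists i, a = alpha i.
Proof.
rewrite /root horner_prod => /eqP/eqP; rewrite prodf_seq_eq0 => /hasP[i _ /=].
rewrite hornerE hornerXsubC expf_eq0 subr_eq0 => /andP[_ /eqP ->].
by exists i.
Qed.

Lemma horner_f_alpha i : f.[alpha i] = 0.
Proof.
apply/eqP; rewrite horner_prod prodf_seq_eq0; apply/hasP; exists i.
  by rewrite mem_index_enum.
by rewrite /= hornerE hornerXsubC subrr expf_eq0 eqxx lambda_gt0.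
Qed.

(** * Centers of the places *)

Definition infinite_place O := place O /\ ~ O x.
Definition place_over (a : K) O := place O /\ maxideal O (x - iota a).
Definition place_at (a b : K) O := place_over a O /\ maxideal O (y - iota b).

Lemma evx_residue a O p : place_over a O -> maxideal O (evx p - iota p.[a]).
Proof.
move=> [hO Ma]; have /factor_theorem[q qE] : root (p - p.[a]%:P) a.
  by rewrite /root !hornerE subrr.
have -> : evx p - iota p.[a] = evx q * (x - iota a).
  by rewrite -evxC -rmorphB qE rmorphM /= evx_XsubC.
apply: (maxidealM hO) => //; apply: (sr_horner (place_subring hO)).
  by move=> i; rewrite coef_map; exact: (place_const hO).
rewrite -(subrK (iota a) x); apply: (srD (place_subring hO)).
  exact: (maxideal_sub Ma).
exact: (place_const hO).
Qed.

Lemma evx_expansion a O p : place_over a O -> p != 0 ->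
  exists2 u, residue_unit O u & evx p = (x - iota a) ^+ mup a p * u.
Proof.
move=> aO p0; have [hO Ma] := aO.
have [n [q]] := multiplicity_XsubC p a; rewrite p0 /= => qa pE.
have -> : mup a p = n by rewrite pE mupMr // mup_XsubCX eqxx.
exists (evx q); first by exists q.[a] => //; exact: evx_residue.
by rewrite {1}pE rmorphM rmorphXn /= evx_XsubC mulrC.
Qed.

Lemma xsubc_neq0 a : x - iota a != 0.
Proof. by rewrite -evx_XsubC (evx_eq0) polyXsubC_eq0. Qed.

Lemma ramified_over_branch i :
  ramified (place_over (alpha i)) (x - iota (alpha i))
    (fun p => (mup (alpha i) p)%:Z).
Proof.
move=> O aO; have [hO Ma] := aO; split=> //; first exact: xsubc_neq0.
by move=> p p0; exact: evx_expansion.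
Qed.

Lemma coprime_branch i : coprimez m (mup (alpha i) f)%:Z.
Proof. by rewrite mup_f; exact: lambda_coprime. Qed.

Lemma ramified_infinity :
  ramified infinite_place x^-1 (fun p => - (size p).-1%:Z).
Proof.
move=> O [hO NOx]; have x0 : x != 0.
  by have := xsubc_neq0 0; rewrite rmorph0 subr0.
have MV := maxideal_inv hO Ex NOx.
split=> //; first by rewrite invr_eq0.
move=> p p0; set d := (size p).-1.
have sp : size p = d.+1 by rewrite prednK // size_poly_gt0.
exists (iota (lead_coef p) + \sum_(i < d) iota p`_i * x^-1 ^+ (d - i)).
  apply: (residue_unitD hE hO).
    by apply: (residue_unitC hO); rewrite lead_coef_eq0.
  apply: (maxideal_sum hE hO) => i _; apply: (maxidealM hO).
    exact: (place_const hO).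
  rewrite -[X in maxideal _ X]/(x^-1 ^ (d - i)%N%:Z).
  by apply: (maxideal_Xz hO) => //; rewrite ltz_nat subn_gt0.
rewrite -[evx p]/(map_poly iota p).[x] (@horner_coef_wide _ d.+1); last first.
  by rewrite size_map_poly sp.
rewrite big_ord_recr /= addrC mulrDr exprz_inv opprK coef_map /lead_coef sp /=.
rewrite [_ * x ^+ d]mulrC; congr (_ + _); rewrite mulr_sumr; apply: eq_bigr => i _.
rewrite coef_map /= mulrCA; congr (_ * _); rewrite exprVn.
rewrite -[x ^ d%:Z]/(x ^+ d) -{2}(subnK (ltnW (ltn_ord i))) exprD.
by rewrite mulrAC divff ?mul1r // expf_neq0.
Qed.

Lemma coprime_infinity : coprimez m (- (size f).-1%:Z).
Proof. by rewrite coprimezN size_f; exact: lambda0_coprime. Qed.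

Lemma evpt_decomp a b (P : {poly {poly K}}) : exists (Q : {poly {poly K}}) q,
  P = Q * ('X - b%:P%:P) + (q * ('X - a%:P) + (evpt a b P)%:P)%:P.
Proof.
have /factor_theorem[Q QE] : root (P - P.[b%:P]%:P) b%:P.
  by rewrite /root !hornerE subrr.
set p := P.[b%:P] in QE; have /factor_theorem[q qE] : root (p - p.[a]%:P) a.
  by rewrite /root !hornerE subrr.
exists Q, q; rewrite -qE -QE.
suff -> : evpt a b P = p.[a] by rewrite subrK subrK.
rewrite -[P in LHS](subrK p%:P) QE rmorphD rmorphM /= rmorphB /= evptX !evptC.
by rewrite hornerC subrr mulr0 add0r.
Qed.

Lemma place_x a O : place_over a O -> O x.
Proof.
move=> [hO /maxideal_sub Oa]; rewrite -(subrK (iota a) x).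
by apply: (srD (place_subring hO)) => //; exact: (place_const hO).
Qed.

Lemma place_evx O p : place O -> O x -> O (evx p).
Proof.
move=> hO Ox; apply: (sr_horner (place_subring hO)) => //.
by move=> i; rewrite coef_map; exact: (place_const hO).
Qed.

Lemma place_y O : place O -> O x -> O y.
Proof.
move=> hO Ox; apply: (place_root (n := m) hO) => //.
by rewrite (y_pow); exact: place_evx.
Qed.

Lemma place_evxy O P : place O -> O x -> O (evxy P).
Proof.
move=> hO Ox; apply: (sr_horner (place_subring hO)); last exact: place_y.
by move=> i; rewrite coef_map; exact: place_evx.
Qed.

Lemma evxy_residue a b O P : place_at a b O -> maxideal O (evxy P - iota (evpt a b P)).
Proof.
move=> [aO Mb]; have [hO Ma] := aO; have Ox := place_x aO.
have [Q [q PE]] := evpt_decomp a b P.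
have -> : evxy P - iota (evpt a b P) = evxy Q * (y - iota b) + evx q * (x - iota a).
  rewrite {1}PE rmorphD rmorphM /= rmorphB /= evxyX !evxyC rmorphD rmorphM /=.
  by rewrite evx_XsubC !evxC addrA addrK.
by apply: (maxidealD hE hO); apply: (maxidealM hO) => //; [exact: place_evxy | exact: place_evx].
Qed.

Section Unramified.
Variables (a b : K).
Hypotheses (bm : b ^+ m = f.[a]) (fa : f.[a] != 0).

Let b_neq0 : b != 0.
Proof. by apply: contraNneq fa => b0; rewrite -bm b0 expr0n (gtn_eqF m_gt0). Qed.

(** The cofactor of Y - b in Y^m - b^m. Its value at (a, b) is m b^(m-1), nonzero because m is
    nonzero in K. *)
Let H : {poly {poly K}} := \sum_(i < m) 'X^(m.-1 - i) * (b%:P%:P) ^+ i.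

Let evptH : evpt a b H != 0.
Proof.
rewrite /H rmorph_sum /=.
under eq_bigr => i _.
  rewrite rmorphM !rmorphXn /= evptX evptC hornerC -exprD subnK; last first.
    by rewrite -ltnS prednK.
  over.
by rewrite sumr_const card_ord -mulr_natl mulf_neq0 // expf_neq0.
Qed.

Let evxyH : exists g, (y - iota b) * evxy H = evx g * (x - iota a).
Proof.
have /factor_theorem[g gE] : root (f - f.[a]%:P) a by rewrite /root !hornerE subrr.
exists g; rewrite -evx_XsubC -rmorphM -gE rmorphB /= evxC -bm rmorphXn /=.
rewrite -(y_pow) subrXX; congr (_ * _); rewrite /H rmorph_sum /=.
apply: eq_bigr => i _; rewrite rmorphM !rmorphXn /= evxyX evxyC evxC.
by rewrite mulrC.
Qed.

(* If P vanishes at (a, b), multiplying it by H extracts a factor x - a. *)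
Let unramified_step P : evpt a b P = 0 -> exists P' B,
  evpt a b B != 0 /\ evxy P * evxy B = (x - iota a) * evxy P'.
Proof.
move=> P0; have [Q [q PE]] := evpt_decomp a b P; have [g hg] := evxyH.
exists (Q * g%:P + q%:P * H), H; split=> //.
rewrite {1}PE P0 addr0 rmorphD rmorphM /= rmorphB /= evxyX !evxyC evxC rmorphM /= evx_XsubC.
rewrite mulrDl -mulrA hg rmorphD !rmorphM /= !evxyC; ring.
Qed.

Let unramified_iter P n :
  (exists (l : nat) A B, [/\ evpt a b A != 0, evpt a b B != 0 &
     evxy P * evxy B = (x - iota a) ^+ l * evxy A]) \/
  (exists A B, evpt a b B != 0 /\ evxy P * evxy B = (x - iota a) ^+ n * evxy A).
Proof.
elim: n => [|n [h|[A [B [B0 AB]]]]]; [|by left|].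
  by right; exists P, 1; rewrite rmorph1 oner_neq0 rmorph1 mulr1 mul1r.
have [A0|A0] := eqVneq (evpt a b A) 0; last by left; exists n, A, B.
right; have [A' [B' [B'0 AB']]] := unramified_step A0.
exists A', (B * B'); rewrite rmorphM mulf_neq0 //; split=> //.
by rewrite rmorphM /= mulrA AB -mulrA AB' exprSr mulrA.
Qed.

(* Only finitely many factors x - a can be extracted, since P divides a nonzero
   polynomial in x by evxy_norm. *)
Lemma unramified_center : local_center (place_at a b) (x - iota a).
Proof.
move=> z /(function_fieldP)[P [d [d0 zE]]] z0.
(* The exponent must be chosen before the place. With no place at (a, b) any exponent does;
   otherwise one such place is used to stop the extraction of factors. *)
have [[O bO]|NO] := pselect (exists O, place_at a b O); last first.
  by exists 0 => O bO; case: NO; exists O.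
have [aO Mb] := bO; have [hO Ma] := aO.
have P0 : evxy P != 0 by apply: contraNneq z0 => P0; rewrite zE P0 mul0r.
have unit_at O' A : place_at a b O' -> evpt a b A != 0 -> residue_unit O' (evxy A).
  by move=> bO' A0; exists (evpt a b A) => //; exact: evxy_residue.
have s0 := xsubc_neq0 a.
suff [l [A [B [A0 B0 AB]]]] : exists (l : nat) A B,
    [/\ evpt a b A != 0, evpt a b B != 0 & evxy P * evxy B = (x - iota a) ^+ l * evxy A].
  exists (l%:Z - (mup a d)%:Z) => O' bO'; have [aO' Mb'] := bO'; have [hO' Ma'] := aO'.
  split=> //; have [v Uv vE] := evx_expansion aO' d0.
  have UA := unit_at _ _ bO' A0; have UB := unit_at _ _ bO' B0.
  exists (evxy A / evxy B / v).
    by apply: (residue_unitM hE hO'); [apply: (residue_unitM hE hO') => // |];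
      exact: (residue_unitV hE hO').
  rewrite zE vE expfzDr // -invr_expz -[_ ^ l%:Z]/(_ ^+ l) -[_ ^ (mup a d)%:Z]/(_ ^+ mup a d).
  have B0' := residue_unit_neq0 hE hO' UB; have v0 := residue_unit_neq0 hE hO' Uv.
  rewrite -[evxy P](mulfK B0') AB.
  have := expf_neq0 (mup a d) s0; move: (_ ^+ mup a d) => w w0.
  by field; rewrite w0 v0 B0'.
have [P' [c [c0 Pc]]] := evxy_norm P0.
(* One factor more than the multiplicity of a in c: cancelling (x - a)^(mup a c) would make the unit
   u B a multiple of x - a. *)
case: (unramified_iter P (mup a c).+1) => // -[A [B [B0 AB]]]; exfalso.
have [u Uu uE] := evx_expansion aO c0.
have UB := unit_at _ _ bO B0.
apply: (residue_unitNmax hE hO (residue_unitM hE hO Uu UB)).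
have -> : u * evxy B = (evxy A * evxy P') * (x - iota a).
  have sn0 := expf_neq0 (mup a c) s0; apply: (mulfI sn0).
  rewrite mulrA -uE -Pc mulrAC AB exprSr; ring.
by apply: (maxidealM hO) => //; rewrite -rmorphM; apply: place_evxy => //; exact: place_x aO.
Qed.

End Unramified.

Lemma place_at_center a b : b ^+ m = f.[a] -> exists t, local_center (place_at a b) t.
Proof.
move=> bm; have [fa|fa] := eqVneq f.[a] 0; last first.
  by exists (x - iota a); exact: unramified_center.
have /root_f[i aE] : root f a by exact/eqP.
subst a; have Es : E (x - iota (alpha i)) by exact: (srB (dr_sr hE)).
have [t [tC _]] := ramified_local_center
  (ramified_over_branch (i := i)) Es (coprime_branch i).
exists t => z Ez z0; have [n hn] := tC z Ez z0; exists n => O [aO _].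
exact: hn.
Qed.

Lemma infinite_center : exists t, local_center infinite_place t.
Proof.
have [t [tC _]] := ramified_local_center
  (ramified_infinity) (dr_V hE Ex) coprime_infinity.
by exists t.
Qed.

(** If x is in [O] but no x - a is in the maximal ideal, every nonzero polynomial in x splits into
    units of [O], so that [O] would be all of [E]. Over a, the product of the y - c for the roots c
    of Y^m - f(a) equals f(x) - f(a), and primality of the maximal ideal selects b. *)
Lemma place_centerP O : place O ->
  infinite_place O \/ exists a b, b ^+ m = f.[a] /\ place_at a b O.
Proof.
move=> hO; have [Ox|NOx] := pselect (O x); [right | by left].
have sO := place_subring hO.
have [[a Ma]|Na] := pselect (exists a, maxideal O (x - iota a)); last first.
  exfalso; case: (hO) => _ _ [_ NE] _; apply: NE => z.
  move=> /(function_fieldP)[P [d [d0 ->]]].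
  apply: (srM sO); first exact: place_evxy.
  apply: contrapT => Nd; apply: Na.
  have : maxideal O (evx d).
    by apply/maxidealP; split; [exact: place_evx | right].
  have [s dE] := closed_field_poly_normal d.
  rewrite {1}dE -mul_polyC rmorphM /= evxC rmorph_prod /=.
  under eq_bigr do rewrite evx_XsubC.
  have Osub c : O (x - iota c) by apply: (srB sO) => //; exact: (place_const hO).
  have Oprod : O (\prod_(c <- s) (x - iota c)) by exact: (sr_prod sO).
  case/(maxideal_prime hO (place_const hO _) Oprod); last exact: (maxideal_prod hO).
  move=> Ml; exfalso; apply: (residue_unitNmax hE hO _ Ml).
  by apply: (residue_unitC hO); rewrite lead_coef_eq0.
have Oy := place_y hO Ox; have aO : place_over a O by [].
have [b Mb] : exists b, maxideal O (y - iota b).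
  have [s sE] := closed_field_poly_normal ('X^m - f.[a]%:P).
  have Osub c : O (y - iota c) by apply: (srB sO) => //; exact: (place_const hO).
  apply: (maxideal_prod hO (s := s) Osub).
  have -> : \prod_(c <- s) (y - iota c) = evx f - iota f.[a].
    have := congr1 (fun p => (map_poly iota p).[y]) sE.
    rewrite /= (monicP _) ?monicXnsubC // scale1r rmorph_prod /=.
    rewrite rmorphB /= map_polyXn map_polyC /= !hornerE -(y_pow) => ->.
    by rewrite horner_prod; apply: eq_bigr => c _; rewrite map_polyXsubC hornerXsubC.
  exact: (evx_residue f aO).
exists a, b; split=> //; apply/eqP; rewrite -subr_eq0; apply: contrapT => ne0.
have := residue_unitC hO (introT negP ne0).
move/(residue_unitNmax hE hO); apply.
have -> : iota (b ^+ m - f.[a]) =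
    (evx f - iota f.[a]) - (evxy 'X^m - iota (evpt a b 'X^m)).
  by rewrite !rmorphXn /= evxyX evptX (y_pow) rmorphB rmorphXn /=; ring.
by apply: (maxidealB hE hO); [exact: (evx_residue f aO) | exact: evxy_residue].
Qed.

Lemma place_param O : place O -> exists t, local_param iota E O t.
Proof.
move=> /place_centerP[iO|[a [b [bm bO]]]].
  by have [t ht] := infinite_center; exists t; exact: local_center_param ht iO.
by have [t ht] := place_at_center bm; exists t; exact: local_center_param ht bO.
Qed.

Lemma place_at_inj a b O O' : b ^+ m = f.[a] -> place_at a b O -> place_at a b O' -> O = O'.
Proof.
by move=> bm; have [t ht] := place_at_center bm; exact: local_center_unique ht.
Qed.

Lemma infinite_place_inj O O' : infinite_place O -> infinite_place O' -> O = O'.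
Proof. by have [t ht] := infinite_center; exact: local_center_unique ht. Qed.

Lemma valuation_xsubc a b O : b ^+ m = f.[a] -> place_at a b O ->
  valuation O (x - iota a) = if f.[a] == 0 then m%:Z else 1.
Proof.
move=> bm bO; have [aO _] := bO; have [hO Ma] := aO.
have Es : E (x - iota a) by exact: (srB (dr_sr hE)).
have [fa|fa] := eqVneq f.[a] 0; last first.
  rewrite -[x - _]mulr1 -{1}[x - _]expr1z.
  apply: (valuation_param hE hO (local_center_param (unramified_center bm fa) bO)).
  exact: (residue_unit1 hO).
have /root_f[i aE] : root f a by exact/eqP.
subst a.
have [vx _] := ramified_valuation
  (ramified_over_branch (i := i)) Es (coprime_branch i) aO.
rewrite -evx_XsubC vx ?polyXsubC_eq0 //.
by rewrite -['X - _]expr1 mup_XsubCX eqxx mulr1.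
Qed.

(** * Functions regular outside the infinite place *)

Variable Q : set F.
Hypothesis Qinf : infinite_place Q.

Let hQ : place Q. Proof. by case: Qinf. Qed.
Let EVx : E x^-1. Proof. exact: (dr_V hE). Qed.

(** The condition [O x] singles out the places other than [Q], the only place where x has a pole. *)
Definition regular (z : F) := forall O, place O -> O x -> O z.

Lemma x_nconst c : x != iota c.
Proof.
by have := xsubc_neq0 c; rewrite subr_eq0.
Qed.

(** If w lies in K[x][1/w], clearing denominators gives a monic equation; otherwise [exists_place]
    yields a place that contains x but omits w. *)
Lemma integral_regular w : E w -> w != 0 -> regular w -> integralOver evx w.
Proof.
move=> Ew w0 rw.
pose A : set F := [set a | exists p : {poly {poly K}}, a = (map_poly evx p).[w^-1]].
have sA : subring_closed [in A].
  apply: subring_closedP.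
  - by exists 1; rewrite rmorph1 hornerC.
  - by move=> _ _ [p ->] [p' ->]; exists (p - p'); rewrite rmorphB /= hornerD hornerN.
  - by move=> _ _ [p ->] [p' ->]; exists (p * p'); rewrite rmorphM /= hornerM.
have Aevx p : A (evx p) by exists p%:P; rewrite map_polyC hornerC.
have AE : A `<=` E.
  move=> _ [p ->]; apply: (sr_horner (dr_sr hE)); last exact: (dr_V hE).
  by move=> i; rewrite coef_map; exact: function_field_evx.
have [[p wE]|NAw] := pselect (A w).
  pose N := size p.
  (* The reversed polynomial: w = p(1/w) multiplied by w^N reads w^(N+1) = H(w). *)
  pose H : {poly {poly K}} := \poly_(i < N.+1) p`_(N - i).
  exists ('X^(N.+1) - H).
    by rewrite monicE lead_coefDl ?lead_coefXn // size_polyN size_polyXn ltnS size_poly.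
  rewrite /root rmorphB /= map_polyXn !hornerE subr_eq0; apply/eqP.
  rewrite (@horner_coef_wide _ N.+1); last first.
    by rewrite (leq_trans (size_poly _ _)) // size_poly.
  rewrite (reindex_inj rev_ord_inj) /= exprSr {2}wE (@horner_coef_wide _ N.+1); last first.
    by rewrite (leq_trans (size_poly _ _)).
  rewrite mulr_sumr; apply: eq_bigr => i _; rewrite !coef_map coef_poly /=.
  have iN : (i <= N)%N by rewrite -ltnS.
  rewrite subSS ltnS leq_subr subKn // mulrCA; congr (_ * _).
  by rewrite -{1}(subnK iN) exprD -mulrA exprVn divff ?mulr1 // expf_neq0.
have [|||O [hO AO NOw]] := @exists_place F k E A w hE sA _ AE Ew NAw.
- by move=> _ [c _ <-]; rewrite -evxC; exact: Aevx.
- by exists 'X; rewrite map_polyX hornerX.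
- have Ax : A x by rewrite -evxX; exact: Aevx.
  by move=> /(_ x Ax)[c _ cx]; have := x_nconst c; rewrite cx eqxx.
case: NOw; apply: rw => //; apply: AO.
by rewrite -evxX; exact: Aevx.
Qed.

Lemma exists_place_over a : exists O, place_over a O.
Proof.
pose A : set F := range evx.
have sA : subring_closed [in A].
  apply: subring_closedP.
  - by exists 1; rewrite ?rmorph1.
  - by move=> _ _ [p _ <-] [p' _ <-]; exists (p - p'); rewrite ?rmorphB.
  - by move=> _ _ [p _ <-] [p' _ <-]; exists (p * p'); rewrite ?rmorphM.
have AE : A `<=` E by move=> _ [p _ <-]; exact: function_field_evx.
have s0 := xsubc_neq0 a.
have As : A (x - iota a) by exists ('X - a%:P); rewrite ?evx_XsubC.
have NA : ~ A (x - iota a)^-1.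
  move=> [p _ pE]; have /eqP : evx (p * ('X - a%:P) - 1) = 0.
    by rewrite rmorphB rmorphM rmorph1 /= evx_XsubC pE mulVf // subrr.
  rewrite (evx_eq0) => /eqP/(congr1 (horner^~ a)) /eqP.
  by rewrite !hornerE subrr mulr0 sub0r oppr_eq0 oner_eq0.
have [||||O [hO AO NO]] := @exists_place F k E A (x - iota a)^-1 hE sA _ AE _ NA.
- by move=> _ [c _ <-]; rewrite -evxC; exists c%:P.
- by apply: (dr_V hE); exact: AE.
- by rewrite invrK.
- have Ax : A x by rewrite -evxX; exists 'X.
  by move=> /(_ x Ax)[c _ cx]; have := x_nconst c; rewrite cx eqxx.
exists O; split=> //; apply/maxidealP; split; [exact: AO | by right].
Qed.

Let valQ := ramified_valuation
  ramified_infinity EVx coprime_infinity Qinf.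

(** Independence of 1, y, ..., y^(m-1) over K(x), hence irreducibility of Y^m - f, follows from the
    distinct orders at [Q]. *)
Lemma evxy_eq0 (P : {poly {poly K}}) : (size P <= m)%N -> evxy P = 0 -> P = 0.
Proof.
move=> sP P0; apply: contrapT => /eqP Pn0.
by have [j [_ /eqP]] := valQ.2 P Pn0 sP; apply.
Qed.

Lemma evpt_eq0 a b P : b ^+ m = f.[a] -> evxy P = 0 -> evpt a b P = 0.
Proof.
move=> bm P0; have [R [sR RP Rpt]] := evxy_reduce P.
by rewrite -Rpt // (evxy_eq0 sR) ?RP // rmorph0.
Qed.

Lemma roots_of_unit_power (c : K) : c != 0 ->
  exists s : seq K, [/\ uniq s, size s = m & forall b, b \in s -> b ^+ m = c].
Proof.
move=> c0; have [s sE] := closed_field_poly_normal ('X^m - c%:P).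
rewrite (monicP _) ?monicXnsubC // scale1r in sE.
exists s; split.
- rewrite -separable_prod_XsubC -sE unlock.
  rewrite derivB derivC subr0 derivXn -scaler_nat coprimepZr //.
  apply: coprimep_expr; rewrite coprimepX /root !hornerE expr0n (gtn_eqF m_gt0).
  by rewrite sub0r oppr_eq0.
- by have := congr1 (fun p : {poly K} => (size p).-1) sE; rewrite /= size_XnsubC // size_prod_XsubC.
- move=> b bs; have : root ('X^m - c%:P) b by rewrite sE root_prod_XsubC.
  by rewrite /root !hornerE subr_eq0 => /eqP.
Qed.

Definition floor_poly (j : nat) : {poly K} :=
  \prod_(i < r) ('X - (alpha i)%:P) ^+ (j * lambda i %/ m).

(** The quotient of f by [floor_poly j] when j < m, so that f is a common denominator of all the
    e_j. *)
Definition cofloor_poly (j : nat) : {poly K} :=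
  \prod_(i < r) ('X - (alpha i)%:P) ^+ (lambda i - j * lambda i %/ m).

Lemma floor_cofloor j : (j < m)%N -> floor_poly j * cofloor_poly j = f.
Proof.
move=> jm; rewrite -big_split /=; apply: eq_bigr => i _.
rewrite -exprD subnKC // -[X in (_ <= X)%N](mulKn _ m_gt0) leq_div2r //.
by rewrite leq_mul2r ltnW ?orbT.
Qed.

Lemma horner_prod_neq0 a (n : 'I_r -> nat) : (forall i, a != alpha i) ->
  (\prod_(i < r) ('X - (alpha i)%:P) ^+ n i).[a] != 0.
Proof.
move=> ha; rewrite horner_prod; apply/prodf_neq0 => i _.
by rewrite !hornerE expf_neq0 // subr_eq0.
Qed.

(* One step of the divisibility below: if sum_j c_j e_j / (x - a), with
   e_j = y^j / floor_poly j, is regular, then every c_j vanishes at a.  The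
   product of this function by (x - a) f is the value of P. *)
Lemma regular_root a w (c : 'I_m -> {poly K}) (P : {poly {poly K}}) :
  E w -> regular w -> (size P <= m)%N ->
  (forall j : 'I_m, P`_j = c j * cofloor_poly j) ->
  evxy P = w * (x - iota a) * evx f ->
  forall j : 'I_m, root (c j) a.
Proof.
move=> Ew rw sP Pc Pw j; have [->|cj0] := eqVneq (c j) 0; first exact: root0.
have Pj0 : P`_j != 0 by rewrite Pc mulf_neq0 ?XsubC_prod_neq0.
have P0 : P != 0 by apply: contraNneq Pj0 => ->; rewrite coef0.
have s0 := xsubc_neq0 a.
have f0 : evx f != 0 by rewrite (evx_eq0) f_neq0.
have w0 : w != 0.
  apply/eqP => w0; have := evxy_eq0 sP; rewrite Pw w0 !mul0r => /(_ erefl).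
  exact/eqP.
have Ef : E (evx f) by exact: function_field_evx.
have Es : E (x - iota a) by exact: (srB (dr_sr hE)).
have [fa|fa] := eqVneq f.[a] 0; last first.
  have /(integral_mul (integral_id evx f)) [G Gmon Gw] := integral_regular Ew w0 rw.
  pose n := (size G).-1.
  have sG : size G = n.+1 by rewrite prednK // size_poly_gt0 monic_neq0.
  have Pab b : b ^+ m = f.[a] -> evpt a b P = 0.
    move=> bm.
    (* The integral equation of f w, homogenized by multiplying with (x - a)^n, becomes a polynomial
       identity in P. At (a, b) every term but P^n vanishes. *)
    pose S : {poly {poly K}} := \sum_(i < n.+1) (G`_i * ('X - a%:P) ^+ (n - i))%:P * P ^+ i.
    have S0 : evxy S = 0.
      rewrite /S rmorph_sum /=.
      transitivity ((x - iota a) ^+ n * (map_poly evx G).[evx f * w]); last first.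
        by rewrite (eqP Gw) mulr0.
      rewrite (@horner_coef_wide _ n.+1) ?mulr_sumr; last by rewrite -sG size_poly.
      apply: eq_bigr => i _; rewrite rmorphM rmorphXn /= evxyC rmorphM rmorphXn /=.
      rewrite evx_XsubC coef_map Pw /= !exprMn.
      have iN : (i <= n)%N by rewrite -ltnS.
      have -> : (x - iota a) ^+ n = (x - iota a) ^+ (n - i) * (x - iota a) ^+ i.
        by rewrite -exprD subnK.
      by ring.
    have := evpt_eq0 bm S0; rewrite /S rmorph_sum /= big_ord_recr /= big1 ?add0r.
      rewrite rmorphM rmorphXn /= evptC subnn expr0 mulr1.
      have -> : G`_n = 1 by rewrite -[G`_n]/(lead_coef G) (monicP Gmon).
      by rewrite hornerC mul1r => /eqP; rewrite expf_eq0 => /andP[_ /eqP].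
    move=> i _; rewrite rmorphM /= evptC !hornerE subrr expr0n subn_eq0 leqNgt ltn_ord.
    by rewrite mulr0 mul0r.
  (* P(a, Y) has degree less than m but vanishes at the m distinct m-th roots of f(a). *)
  have [s [us ss hs]] := roots_of_unit_power fa.
  pose p := map_poly (horner_eval a) P.
  have p0 : p = 0.
    apply: contrapT => /eqP p0.
    have /allP rp : {in s, forall b, root p b}.
      by move=> b /hs bm; rewrite /root; have /eqP := Pab b bm.
    by have := max_poly_roots p0 rp us; rewrite ss ltnNge (leq_trans (size_poly _ _)).
  have : p`_j = 0 by rewrite p0 coef0.
  rewrite coef_map Pc /= /horner_eval hornerM => /eqP; rewrite mulf_eq0 => /orP[//|].
  rewrite (negPf (horner_prod_neq0 _ _)) // => i; apply: contraNneq fa => ->.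
  by rewrite horner_f_alpha.
have /root_f[i aE] : root f a by exact/eqP.
subst a; have [O aO] := exists_place_over (alpha i); have [hO Ma] := aO.
have [vx vP] := ramified_valuation
  (ramified_over_branch (i := i)) Es (coprime_branch i) aO.
(* The order of P is at most that of its term of index j, which is m mup(c_j) + m lambda_i + (j
   lambda_i mod m); it is at least m + m lambda_i as w is regular. The remainder being less than m,
   mup(c_j) is positive. *)
have [j0 [[_ _ /(_ j Pj0) vj] _]] := vP P P0 sP; move: vj.
have pO := place_param hO.
have Ews : E (w * (x - iota (alpha i))) by exact: (srM (dr_sr hE)).
rewrite Pw (valuationM hE hO pO) ?mulf_neq0 // (valuationM hE hO pO) //.
rewrite vx ?f_neq0 // -{1}evx_XsubC vx ?polyXsubC_eq0 //.
rewrite -['X - _]expr1 mup_XsubCX eqxx mup_f.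
have v0 : 0 <= valuation O w.
  by apply/(valuation_ge0 hE hO pO) => //; apply: rw => //; exact: place_x aO.
rewrite Pc mupM ?XsubC_prod_neq0 // mup_alpha -dvdp_XsubCl XsubC_dvd //.
have := floor_mod m lambda j i; have := ltn_pmod (j * lambda i) m_gt0.
have le_l : (j * lambda i %/ m <= lambda i)%N.
  by rewrite -[X in (_ <= X)%N](mulKn _ m_gt0) leq_div2r // leq_mul2r ltnW ?orbT.
move: (valuation O w) v0 (mup _ _) le_l => v v0 u.
move: (j * lambda i %/ m)%N (j * lambda i %% m)%N (lambda i) => d e l; nia.
Qed.

Lemma regular_mul z w : regular z -> regular w -> regular (z * w).
Proof.
by move=> rz rw O hO Ox; apply: (srM (place_subring hO)); [exact: rz | exact: rw].
Qed.

Lemma regular_evx p : regular (evx p).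
Proof. by move=> O hO Ox; exact: (place_evx p hO Ox). Qed.

(** In the basis e_j the coefficients of R/d are R_j [floor_poly j] / d, and the claim is that they
    are polynomials. The roots of d are removed one at a time by [regular_root]. *)
Lemma regular_dvd (d : {poly K}) (R : {poly {poly K}}) : d != 0 -> (size R <= m)%N ->
  regular (evxy R / evx d) -> forall j : 'I_m, d %| R`_j * floor_poly j.
Proof.
move=> + sR; have [n] := ubnP (size d); elim: n d => // n IHn d.
rewrite ltnS => sd d0 rz j; have [d1|/closed_rootP[a]] := eqVneq (size d) 1%N.
  by apply: dvdp_trans (dvd1p _); rewrite dvdp1 d1.
move=> /factor_theorem[d' dE].
have d'0 : d' != 0 by apply: contraNneq d0 => d'0; rewrite dE d'0 mul0r.
have sd' : (size d' < n)%N by rewrite dE size_Mmonic ?monicXsubC // size_XsubC addn2 in sd.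
have s0 := xsubc_neq0 a.
have ed' : evx d' != 0 by rewrite (evx_eq0).
have zE : evxy R / evx d' = evxy R / evx d * (x - iota a).
  by rewrite dE rmorphM /= evx_XsubC; field; rewrite s0 ed'.
have rz' : regular (evxy R / evx d').
  by rewrite zE -evx_XsubC; apply: regular_mul => //; exact: regular_evx.
have dv := IHn d' sd' d'0 rz'.
pose c i := (R`_i * floor_poly i) %/ d'.
have cE (i : 'I_m) : R`_i * floor_poly i = c i * d' by rewrite /c (divpK (dv i)).
pose P : {poly {poly K}} := \poly_(i < m) (c i * cofloor_poly i).
have Ez : E (evxy R / evx d).
  by apply: (dr_div hE); [exact: function_field_evxy | exact: function_field_evx].
have Pw : evxy P = evxy R / evx d * (x - iota a) * evx f.
  apply: (mulIf ed'); rewrite -zE mulrAC divfK //.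
  rewrite (evxy_sum (size_poly _ _)) (evxy_sum sR) !mulr_suml.
  apply: eq_bigr => i _; rewrite coef_poly ltn_ord !rmorphM /=.
  rewrite -(floor_cofloor (ltn_ord i)) rmorphM /=.
  have := congr1 evx (cE i); rewrite !rmorphM /= => h.
  by rewrite mulrAC -[evx (c i) * _ * _]mulrAC -h; ring.
have Pc (i : 'I_m) : P`_i = c i * cofloor_poly i by rewrite coef_poly ltn_ord.
have /factor_theorem[b bE] := regular_root (c := fun i => c i) Ez rz (size_poly _ _)
  Pc Pw j.
by rewrite cE bE dE [d' * _]mulrC dvdp_mul // dvdp_mull.
Qed.

(** The term that dominates at [Q] is c e_j with c a polynomial by [regular_dvd], and n is the
    degree of c. *)
Lemma regular_valuation z : E z -> z != 0 -> regular z ->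
  exists (j : 'I_m) n, valuation Q z = - (apery j + m * n)%N%:Z.
Proof.
move=> /(function_fieldP)[P [d [d0 zE]]] z0 rz.
have [R [sR RP _]] := evxy_reduce P; rewrite -RP in zE.
have R0 : R != 0.
  by apply: contraNneq z0 => R0; rewrite zE R0 rmorph0 mul0r.
have [vx vxy] := valQ; have [j [[Rj vR _] eR0]] := vxy R R0 sR.
have := regular_dvd d0 sR; rewrite -zE => /(_ rz j)/dvdpP[c cE].
have g0 : floor_poly j != 0 := XsubC_prod_neq0 _.
have c0 : c != 0.
  by apply: contraNneq (mulf_neq0 Rj g0) => c0; rewrite cE c0 mul0r.
exists j, (size c).-1.
have ed : evx d != 0 by rewrite (evx_eq0).
have Ed : E (evx d) by exact: function_field_evx.
rewrite zE (valuationM hE hQ (place_param hQ)) ?invr_eq0 //; last 2 first.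
- exact: function_field_evxy.
- exact: (dr_V hE).
rewrite (valuationV hE hQ (place_param hQ)) // vR vx // size_f /=.
have := congr1 (fun p : {poly K} => size p) cE; rewrite /= !size_mul // size_XsubC_prod.
have := apery_floor m lambda j; move: c0 d0 Rj; rewrite -!size_poly_gt0.
move: (size c) (size d) (size R`_j) (apery j) (\sum_(i < r) _)%N (\sum_(i < r) _)%N.
by move=> c' d' r' a b e; nia.
Qed.

Definition apery_fun (j : nat) : F := y ^+ j / evx (floor_poly j).

Let y_neq0 : y != 0.
Proof.
have : evx f != 0 by rewrite (evx_eq0) f_neq0.
by rewrite -(y_pow) expf_eq0 m_gt0.
Qed.

Lemma apery_fun_neq0 j : apery_fun j != 0.
Proof. by rewrite mulf_neq0 ?expf_neq0 // invr_eq0 (evx_eq0) XsubC_prod_neq0. Qed.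

Lemma apery_fun_in j : E (apery_fun j).
Proof.
by apply: (dr_div hE); [exact: (srX (dr_sr hE)) | exact: function_field_evx].
Qed.

(** This power is a polynomial in x of degree [apery j], which yields both the regularity of e_j, by
    extraction of m-th roots in a valuation ring, and its pole order at [Q]. *)
Lemma apery_fun_pow j :
  apery_fun j ^+ m = evx (\prod_(i < r) ('X - (alpha i)%:P) ^+ (j * lambda i %% m)).
Proof.
have g0 : evx (floor_poly j) != 0 by rewrite (evx_eq0) XsubC_prod_neq0.
apply: (mulIf (expf_neq0 m g0)).
rewrite -exprMn divfK // exprAC (y_pow) -!rmorphXn -rmorphM; congr (evx _).
rewrite -!prodrXl -big_split /=; apply: eq_bigr => i _.
by rewrite -!exprM -exprD addnC [(_ * m)%N]mulnC floor_mod mulnC.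
Qed.

Lemma regular_apery_fun j : regular (apery_fun j).
Proof.
move=> O hO Ox; apply: (place_root (n := m) hO) => //; first exact: apery_fun_in.
by rewrite apery_fun_pow; exact: (place_evx _ hO Ox).
Qed.

Lemma valuation_apery_fun j n :
  valuation Q (x ^+ n * apery_fun j) = - (apery j + m * n)%N%:Z.
Proof.
have pQ := place_param hQ; have [vx _] := valQ.
have x0 : x != 0 by have := xsubc_neq0 0; rewrite rmorph0 subr0.
rewrite (valuationM hE hQ pQ) ?expf_neq0 ?apery_fun_neq0 //; last 2 first.
- exact: (srX (dr_sr hE)).
- exact: apery_fun_in.
have vxn : valuation Q (x ^+ n) = - (m * n)%N%:Z.
  rewrite -evxX -rmorphXn vx ?expf_neq0 ?polyX_eq0 // size_polyXn /=.
  by rewrite PoszM mulrN.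
have := valuationX hE hQ pQ m (apery_fun_in j) (apery_fun_neq0 j).
rewrite apery_fun_pow vx ?XsubC_prod_neq0 // size_XsubC_prod /= -/(apery j) vxn.
move: (valuation Q _) => v; rewrite -mulr_natl natz; nia.
Qed.

(** * The semigroup at infinity and the multiples of the infinite place *)

Let regval := regular_valuation.

Lemma place_neq_infinite O : place O -> O != Q -> O x.
Proof.
move=> hO OQ; apply: contrapT => NOx; move/eqP: OQ; apply.
exact: (infinite_place_inj).
Qed.

Lemma regular_pole s : apery_semigroup s ->
  exists z, [/\ E z, z != 0, regular z & valuation Q z = - s%:Z].
Proof.
move=> /apery_semigroupP[j [n ->]].
exists (x ^+ n * apery_fun j).
have x0 : x != 0 by have := xsubc_neq0 0; rewrite rmorph0 subr0.
split.
- apply: (srM (dr_sr hE)); first exact: (srX (dr_sr hE)).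
  exact: apery_fun_in.
- by rewrite mulf_neq0 ?expf_neq0 // (apery_fun_neq0).
- move=> O hO Ox; apply: (srM (place_subring hO)); first exact: (srX (place_subring hO)).
  exact: (regular_apery_fun).
- exact: (valuation_apery_fun).
Qed.

Lemma weierstrassE s : weierstrass k E Q s <-> apery_semigroup s.
Proof.
split=> [[z [Ez z0 hz]]|/regular_pole[z [Ez z0 rz vz]]].
  have rz : regular z.
    move=> O hO Ox; apply/(valuation_ge0 hE hO (place_param hO) Ez z0).
    have := hz O hO; have [OQ|_] := eqVneq O Q.
      by case: Qinf => _; rewrite -OQ.
    by rewrite /pole_divisor; lia.
  have [j [n vz]] := regval Ez z0 rz.
  apply/apery_semigroupP; exists j, n.
  by have := hz Q hQ; rewrite /pole_divisor eqxx vz; lia.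
exists z; split=> // P hP; rewrite /pole_divisor; have [->|PQ] := eqVneq P Q.
  by rewrite vz; lia.
have Px := place_neq_infinite hP PQ.
have /(valuation_ge0 hE hP (place_param hP) Ez z0) := rz P hP Px.
by lia.
Qed.

Lemma RRspace_negative D : (forall P, D P <= 0) -> D Q < 0 -> RR D `<=` [set 0].
Proof.
move=> D0 DQ z /(RRspaceP iota)[Ez hz]; apply: contrapT => /eqP z0.
have rz : regular z.
  move=> O hO Ox; apply/(valuation_ge0 hE hO (place_param hO) Ez z0).
  by apply: le_trans (hz O hO z0); rewrite oppr_ge0.
have [j [n vz]] := regval Ez z0 rz.
by have := hz Q hQ z0; rewrite vz; lia.
Qed.

Definition multiple_Q (N : int) : set F -> int := fun P => if P == Q then N else 0.

(** The dimension grows at the step from N - 1 to N exactly when N is a pole order. The shift by one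
    starts the induction at L(-Q) = 0. *)
Lemma has_dim_multiple_Q N :
  has_dim k (RR (multiple_Q (N%:Z - 1))) [set 0] (\sum_(0 <= s < N) apery_semigroup s).
Proof.
elim: N => [|N IHN].
  rewrite big_geq //; have -> : RR (multiple_Q (0%:Z - 1)) = [set 0]; last exact: has_dim0.
  apply/seteqP; split; last by move=> _ ->;
    case: (RRspace_subspace hE kE place_param (multiple_Q (0%:Z - 1))).
  by apply: RRspace_negative => [P|]; rewrite /multiple_Q ?eqxx //; case: (_ == _).
have DE : RR (multiple_Q (N.+1%:Z - 1)) = RR (add_place (multiple_Q (N%:Z - 1)) Q).
  apply: RRspace_eq => P _; rewrite /multiple_Q /add_place.
  by case: (P == Q) => /=; lia.
rewrite big_nat_recr //= DE; have [NS|NNS] := boolP (apery_semigroup N).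
  rewrite addn1; have [z [Ez z0 rz vz]] := regular_pole NS.
  apply: (RRspace_add_pole hE kE place_param hQ _ z0 _ IHN); last first.
    by rewrite vz /multiple_Q eqxx subrK.
  apply/(RRspaceP iota); split=> // P hP _; rewrite /add_place /multiple_Q.
  have [->|PQ] := eqVneq P Q; first by rewrite subrK vz.
  rewrite addr0 oppr0; apply/(valuation_ge0 hE hP (place_param hP) Ez z0).
  by apply: rz => //; exact: place_neq_infinite.
rewrite addn0.
have -> // : RR (add_place (multiple_Q (N%:Z - 1)) Q) = RR (multiple_Q (N%:Z - 1)).
apply/seteqP; split; last exact: RRspace_add_sub.
move=> z /(RRspaceP iota)[Ez hz]; apply/(RRspaceP iota); split=> // P hP z0.
have rz : regular z.
  move=> O hO Ox; apply/(valuation_ge0 hE hO (place_param hO) Ez z0).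
  apply: le_trans (hz O hO z0); rewrite /add_place /multiple_Q.
  by case: eqVneq Ox => [->|]; [case: Qinf | rewrite addr0 oppr0].
have [j [n vz]] := regval Ez z0 rz.
have := hz P hP z0; rewrite /add_place /multiple_Q;
  have [->|_] := eqVneq P Q; last by rewrite addr0.
rewrite vz subrK => vN.
have nN : (apery j + m * n)%N != N.
  by apply: contra NNS => /eqP <-; apply/apery_semigroupP; exists j, n.
by move: vN nN; move: (apery j + m * n)%N => a; lia.
Qed.

(** * Zeros of x - a and common denominators *)

Let Esub a : E (x - iota a). Proof. exact: (srB (dr_sr hE)). Qed.
Let sub0 a : x - iota a != 0. Proof. exact: xsubc_neq0. Qed.

Lemma place_over_at a O : place_over a O -> exists b, b ^+ m = f.[a] /\ place_at a b O.
Proof.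
move=> aO; have [hO Ma] := aO.
case: (place_centerP hO) => [[_ NOx]|[a' [b [bm bO]]]].
  by case: NOx; exact: place_x aO.
suff -> : a = a' by exists b.
have [[_ Ma'] _] := bO; apply/eqP; rewrite -subr_eq0; apply: contrapT => /negP ne0.
apply: (residue_unitNmax hE hO (residue_unitC hO ne0)).
have -> : iota (a - a') = (x - iota a') - (x - iota a) by rewrite rmorphB; ring.
exact: (maxidealB hE hO).
Qed.

Lemma exists_place_center O : place O -> O x -> exists a, place_over a O.
Proof.
move=> hO Ox; case: (place_centerP hO) => [[_ //]|[a [b [_ [aO _]]]]].
by exists a.
Qed.

Lemma places_over_finite a : exists s : seq (set F),
  forall O, place_over a O -> O \in s.
Proof.
have [rs rsE] := closed_field_poly_normal ('X^m - f.[a]%:P).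
rewrite (monicP _) ?monicXnsubC // scale1r in rsE.
exists [seq xget set0 (place_at a b) | b <- rs] => O /place_over_at[b [bm bO]].
apply/mapP; exists b.
  have : root ('X^m - f.[a]%:P) b by rewrite /root !hornerE bm subrr.
  by rewrite rsE root_prod_XsubC.
apply: (place_at_inj bm bO).
by apply: (@xgetPex _ _ (place_at a b)); exists O.
Qed.

(** Distinct places over a are centered at distinct m-th roots b of f(a). If f(a) is nonzero there
    are at most m of them, each a simple zero; if f(a) = 0 only b = 0 is left, a zero of order m. *)
Lemma sum_places_over a (T : seq (set F)) : uniq T ->
  (forall P, P \in T -> place_over a P) ->
  \sum_(P <- T) valuation P (x - iota a) <= m%:Z.
Proof.
move=> uT hT.
have /choice[b hb] P : exists b, place_over a P -> b ^+ m = f.[a] /\ place_at a b P.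
  have [/place_over_at[b hb]|NP] := pselect (place_over a P); first by exists b.
  by exists 0.
have b_inj : {in T &, injective b}.
  move=> P P' /hT /hb[bm bP] /hT /hb[_ bP'] bb; rewrite -bb in bP'.
  exact: (place_at_inj bm).
have ub : uniq (map b T) by rewrite map_inj_in_uniq.
rewrite big_seq; under eq_bigr => P PT.
  have [bm bP] := hb P (hT P PT).
  rewrite (valuation_xsubc bm bP).
  over.
rewrite -big_seq /=; case: ifPn => fa.
  have sT : (size T <= 1)%N.
    rewrite -(size_map b); apply: (@uniq_leq_size _ _ [:: 0] ub) => _ /mapP[P PT ->].
    have [/eqP bm _] := hb P (hT P PT); rewrite (eqP fa) expf_eq0 m_gt0 /= in bm.
    by rewrite inE.
  by rewrite big_const_seq count_predT; case: (size T) sT => [|[|//]] //= _; rewrite ?addr0.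
have sT : (size T <= m)%N.
  have p0 : 'X^m - f.[a]%:P != 0 by rewrite monic_neq0 ?monicXnsubC.
  have := @max_poly_roots _ _ (map b T) p0 _ ub.
  rewrite size_map size_XnsubC // ltnS; apply; apply/allP => _ /mapP[P PT ->].
  by have [bm _] := hb P (hT P PT); rewrite /root !hornerE bm subrr.
by rewrite big_const_seq count_predT iter_addr_0 natz lez_nat.
Qed.

Lemma valuation_sub_ge0 a O : place O -> O != Q -> 0 <= valuation O (x - iota a).
Proof.
move=> hO OQ; apply/(valuation_ge0 hE hO (place_param hO)) => //.
apply: (srB (place_subring hO)); last exact: (place_const hO).
exact: (place_neq_infinite).
Qed.

Lemma valuation_sub_infinite a : valuation Q (x - iota a) = - m%:Z.
Proof.
have [vx _] := ramified_valuation
  ramified_infinity EVx coprime_infinity Qinf.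
by rewrite -evx_XsubC vx ?polyXsubC_eq0 // size_XsubC /= mulrN mulr1.
Qed.

(** The pole at [Q] contributes -m and the zeros at most m, by [sum_places_over]. *)
Lemma sum_valuation_sub a (T : seq (set F)) : uniq T -> Q \in T ->
  (forall P, P \in T -> place P) -> \sum_(P <- T) valuation P (x - iota a) <= 0.
Proof.
move=> uT QT hT; pose T' := [seq P <- T | `[< place_over a P >]].
have := @sum_places_over a T' (filter_uniq _ uT) _; rewrite /T' big_filter.
have hT' P : P \in [seq P <- T | `[< place_over a P >]] -> place_over a P.
  by rewrite mem_filter => /andP[/asboolP].
move=> /(_ hT') le_m.
have NQ : ~ place_over a Q by move=> aQ; case: Qinf => _; apply; exact: place_x aQ.
rewrite (bigD1_seq Q) //= valuation_sub_infinite (bigID (fun P => `[< place_over a P >])) /=.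
rewrite [X in _ + (X + _)](eq_bigl (fun P => `[< place_over a P >])); last first.
  move=> P; rewrite andbC andb_idr // => /asboolP aP; apply/eqP => PQ.
  by apply: NQ; rewrite -PQ.
rewrite [X in _ + (_ + X)]big_seq_cond [X in _ + (_ + X)]big1.
  by rewrite addr0 addrC subr_le0.
move=> P /andP[PT /andP[PQ /asboolPn NP]]; have hP := hT P PT.
apply/eqP; rewrite eq_le valuation_sub_ge0 // andbT leNgt; apply/negP.
by move=> /(valuation_gt0 hE hP (place_param hP) (Esub a) (sub0 a)) Ma; apply: NP.
Qed.

(** h is the product of (x - a_P)^N over the support of D outside [Q], where P lies over a_P and N
    bounds every coefficient of D. The list T collects [Q], the support of D and all places over the
    a_P, so that no zero or pole of h is missed. *)
Lemma exists_denominator D : is_divisor k E D -> exists h T, [/\ E h /\ h != 0,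
     uniq T /\ Q \in T,
     (forall P, P \in T -> place P),
     (forall P, D P != 0 \/ place P /\ valuation P h != 0 -> P \in T) &
     (forall P, place P -> P != Q -> D P <= valuation P h) /\
     \sum_(P <- T) valuation P h <= 0].
Proof.
move=> [/finite_seqP[s sE] Dpl].
have sP P : (D P != 0) = (P \in s).
  by have /= h := congr1 (fun A : set (set F) => A P) sE; apply/idP/idP; rewrite h.
have /choice[a ha] P : exists a, place P -> P != Q -> place_over a P.
  have [[hP PQ]|NP] := pselect (place P /\ P != Q); last by exists 0 => hP PQ; case: NP.
  have Px := place_neq_infinite hP PQ.
  by have [a aP] := exists_place_center hP Px; exists a.
have /choice[L hL] := places_over_finite.
pose N := (\sum_(P <- s) `|D P|)%N.
pose s' := [seq P <- s | P != Q].
pose h := \prod_(P <- s') (x - iota (a P)) ^+ N.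
pose T := undup (Q :: s ++ [seq P <- flatten [seq L (a P) | P <- s'] | `[< place P >]]).
have E1 P : E ((x - iota (a P)) ^+ N) by exact: (srX (dr_sr hE)).
have n1 P : (x - iota (a P)) ^+ N != 0 by rewrite expf_neq0.
have Eh : E h by apply: (sr_prod (dr_sr hE)).
have h0 : h != 0 by rewrite /h; elim/big_ind: _ => //; [exact: oner_neq0 | exact: mulf_neq0].
have vh P : place P -> valuation P h = \sum_(P' <- s') valuation P (x - iota (a P')) *+ N.
  move=> hP; rewrite /h (valuation_prod hE hP (place_param hP)) //.
  by apply: eq_bigr => P' _; rewrite (valuationX hE hP (place_param hP)).
have hT P : P \in T -> place P.
  rewrite mem_undup inE mem_cat mem_filter => /or3P[/eqP -> //|Ps|/andP[/asboolP //]].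
  by apply: Dpl; rewrite /= sP.
have QT : Q \in T by rewrite mem_undup mem_head.
exists h, T; split=> //.
- by rewrite undup_uniq.
- move=> P [DP|[hP vP]]; rewrite mem_undup inE mem_cat; first by rewrite -sP DP orbT.
  have [//|PQ] := eqVneq P Q; rewrite mem_filter asboolT //=; apply/orP; right.
  apply: contrapT => NP; move/eqP: vP; apply; rewrite vh // big_seq big1 // => P' P's.
  suff -> : valuation P (x - iota (a P')) = 0 by rewrite mul0rn.
  apply/eqP; rewrite eq_le valuation_sub_ge0 // andbT leNgt; apply/negP.
  move=> /(valuation_gt0 hE hP (place_param hP) (Esub _) (sub0 _)) Ma; apply: NP.
  by apply/flattenP; exists (L (a P')); [exact: map_f | exact: hL].
- split.
    move=> P hP PQ; rewrite vh //; have [->|DP] := eqVneq (D P) 0.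
      by rewrite sumr_ge0 // => P' _; rewrite mulrn_wge0 // valuation_sub_ge0.
    have Ps : P \in s by rewrite -sP.
    have Ps' : P \in s' by rewrite mem_filter PQ.
    rewrite (big_rem P) //=; apply: ler_wpDr.
      by rewrite sumr_ge0 // => P' _; rewrite mulrn_wge0 // valuation_sub_ge0.
    have v1 : 1 <= valuation P (x - iota (a P)).
      rewrite -gtz0_ge1; apply/(valuation_gt0 hE hP (place_param hP)) => //.
      by case: (ha P hP PQ).
    have DN : (`|D P| <= N)%N by rewrite /N (big_rem P) //= leq_addr.
    by move: v1 DN; rewrite -mulr_natr natz; move: (valuation _ _) (D P) => v d; nia.
  have -> : \sum_(P <- T) valuation P h =
      \sum_(P <- T) \sum_(P' <- s') valuation P (x - iota (a P')) *+ N.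
    by rewrite big_seq [RHS]big_seq; apply: eq_bigr => P /hT hP; exact: vh.
  rewrite exchange_big /= sumr_le0 // => P' _; rewrite sumrMnl.
  rewrite mulrn_wle0 //; apply: sum_valuation_sub => //.
  exact: undup_uniq.
Qed.

Lemma curve_genusE : (0 < r)%N -> curve_genus iota x y = apery_genus m lambda.
Proof.
move=> r_gt0; apply: (genusE hE kE place_param hQ) => [D D0 DQ|N|D hD].
- exact: (RRspace_negative D0 DQ).
(* m M is a whole number of blocks reaching beyond all gaps, so the count below it is exact; the
   divisor is (m M - 1) [Q] because of the shift in [has_dim_multiple_Q]. *)
- pose M := (N + apery_genus m lambda).+1;
  exists (m * M).-1, (\sum_(0 <= s < m * M) apery_semigroup s)%N.
  have mM : (0 < m * M)%N by rewrite muln_gt0 m_gt0.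
  rewrite prednK //; split.
  + by rewrite -ltnS prednK //; rewrite /M; nia.
  + by rewrite count_apery_genus // /M; lia.
  + have := has_dim_multiple_Q (m * M).
    congr (has_dim _ (RRspace _ _ _) _ _); apply/funext => P.
    by rewrite /multiple_Q; case: (P == Q) => //; lia.
- exact: exists_denominator.
Qed.

End KummerExtension.

Theorem theorem3 (p n q m r : nat)
    (Fq : finFieldType) (K : closedFieldType) (j : {rmorphism Fq -> K})
    (alpha : 'I_r -> K) (lambda : 'I_r -> nat)
    (F : fieldType) (iota : {rmorphism K -> F}) (x y : F) (Qinf : set F)
    (* q is a power of the prime p, K is the algebraic closure of F_q *)
    (p_prime : prime p) (n_gt0 : (0 < n)%N) (q_def : q = (p ^ n)%N)
    (card_Fq : #|Fq| = q) (K_alg : forall a : K, algebraicOver j a)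
    (m_ge2 : (2 <= m)%N) (r_ge2 : (2 <= r)%N) (p_ndvd_m : ~~ (p %| m)%N)
    (alpha_inj : injective alpha)
    (lambda_bnd : forall i, (1 <= lambda i < m)%N)
    (lambda0_coprime : coprime m (\sum_(i < r) lambda i)%N)
    (* the function field K(x, y) of X *)
    (x_trans : ~ algebraicOver iota x)
    (xy_eq : y ^+ m = \prod_(i < r) (x - iota (alpha i)) ^+ lambda i)
    (* Q_oo lies over the pole of x *)
    (Qinf_place : curve_places iota x y Qinf) (Qinf_pole : ~ Qinf x)
    (* X is defined over F_{q^2} *)
    (X_def : \prod_(i < r) ('X - (alpha i)%:P) ^+ lambda i
               \is a polyOver [in GF_sub K (q ^ 2)])
    (lambda_coprime : forall i, coprime m (lambda i))
    (r_lt_m : (r < m)%N) :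
  maximal_castle_curve iota x y q Qinf <->
  [/\ maximal_curve iota x y q,
      (forall i i', lambda i = lambda i')
    & m = q.+1].
Proof.
have m_gt0 : (0 < m)%N by exact: ltnW.
have r_gt0 : (0 < r)%N by exact: ltnW.
have q_gt0 : (0 < q)%N by rewrite q_def expn_gt0 prime_gt0.
have m_neq0 : m%:R != 0 :> K.
  have pK : p \in [pchar K].
    by apply: (rmorph_pchar j); apply: (card_finPcharP (n := n)) => //; rewrite card_Fq.
  by rewrite -(dvdn_pcharf pK).
have lambda_gt0 i : (0 < lambda i)%N by case/andP: (lambda_bnd i).
have Qi : infinite_place iota x y Qinf by [].
have genusE := curve_genusE m_gt0 m_neq0 alpha_inj lambda_gt0 lambda_coprime
  lambda0_coprime x_trans xy_eq Qi r_gt0.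
have gE := apery_genusE m_gt0 r_gt0 lambda_coprime lambda0_coprime.
have HS := weierstrassE m_gt0 m_neq0 alpha_inj lambda_gt0 lambda_coprime
  lambda0_coprime x_trans xy_eq Qi.
have mr : (0 < (m - 1) * (r - 1))%N by nia.
rewrite -genusE in gE; set g := curve_genus iota x y in gE.
have multE l : (forall i, lambda i = l) -> multiplicity (curve_semigroup iota x y Qinf) = r.
  by move=> lE; exact: (multiplicity_equal m_ge2 r_gt0 lambda_coprime lambda0_coprime lE r_lt_m HS).
split=> [[[[f [Nf _] fg] castle] maxi]|[maxi leq mq]].
  have leq i i' : lambda i = lambda i'.
    have fE : f = ((m - 1) * (r - 1) - 1)%N by rewrite -/g in fg; lia.
    have Nf' : ~~ apery_semigroup m lambda ((m - 1) * (r - 1) - 1).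
      by apply/negP => /HS; rewrite -fE.
    (* The congruence modulo m is an equality because every lambda_i is less than m. *)
    have := frobenius_all_equal m_ge2 r_gt0 lambda0_coprime mr Nf' i i'.
    by rewrite !modn_small //; case/andP: (lambda_bnd i); case/andP: (lambda_bnd i').
  split=> //.
  (* Both cardinals are those of [curve_points]. With 2 g = (m - 1) (r - 1), the positive factor (r
     - 1) q cancels and leaves q = m - 1. *)
  have /card_eq_II : (`I_(q ^ 2 * r + 1) #= `I_(q ^ 2 + 1 + 2 * g * q))%card.
    rewrite -(multE (lambda (Ordinal r_gt0))) //.
    by apply: card_eq_trans maxi; rewrite card_eq_sym.
  by rewrite gE; nia.
split=> //; split.
  exists ((m - 1) * (r - 1) - 1)%N; last by rewrite -/g; lia.
  exact: (frobenius_equal m_ge2 r_gt0 lambda_coprime lambda0_coprime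
    (fun i => leq i (Ordinal r_gt0)) mr HS).
rewrite (multE (lambda (Ordinal r_gt0))) //.
suff -> : (q ^ 2 * r + 1 = q ^ 2 + 1 + 2 * g * q)%N by [].
by rewrite gE mq; nia.
Qed.
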